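(* Let $T=M_wEM_u$ be a bounded weighted conditional expectation operator on $L^2(\mathcal{F})$ with $w,u\ge 0$, let $\widehat{T}$ be its Aluthge transformation, and let $v_n=\sum_{i=0}^{n-2}(E(uw))^i$. Then the following are equivalent: (a) $T$ is Cesaro bounded. (b) $\widehat{T}$ is Cesaro bounded. (c) The sequence $\{n^{-1}\|v_n\|_\infty\}_{n\in\mathbb{N}}$ is uniformly bounded. (d) The sequence $\{n^{-1}\|v_n(E(|u|^2))^{1/2}(E(|w|^2))^{1/2}\|_\infty\}_{n\in\mathbb{N}}$ is uniformly bounded.
   Context: $(X,\mathcal{F},\mu)$ is a complete $\sigma$-finite measure space and $\mathcal{A}\subseteq\mathcal{F}$ is a $\sigma$-subalgebra such that $(X,\mathcal{A},\mu|_{\mathcal{A}})$ is also $\sigma$-finite. Statements about sets and functions hold up to sets of measure zero. $L^0(\mathcal{F})$ is the set of (classes of) $\mathcal{F}$-measurable complex-valued functions, and $L^2(\mathcal{F})=L^2(X,\mathcal{F},\mu)$. $E=E^{\mathcal{A}}$ is the conditional expectation with respect to $\mathcal{A}$: $E(f)$ is the unique $\mathcal{A}$-measurable function with $\int_A E(f)\,d\mu=\int_A f\,d\mu$ for all $A\in\mathcal{A}$, defined for $f\ge 0$ and for $f\in L^2(\mathcal{F})$, and extended to conditionable functions (those with $E(|f|)<\infty$ a.e.). For $u,w\in L^0(\mathcal{F})$ such that $uf$ is conditionable and $wE(uf)\in L^2(\mathcal{F})$ for all $f\in L^2(\mathcal{F})$, the weighted conditional expectation operator $T=M_wEM_u$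 on $L^2(\mathcal{F})$ is $Tf=wE(uf)$; it is assumed to be bounded (then $E(uw)$ is defined and lies in $L^\infty(\mathcal{A})$). The Aluthge transformation of $T=M_wEM_u$ on $L^2(\mathcal{F})$ is given by $\widehat{T}(f)=\frac{\chi_S E(uw)}{E(|u|^2)}\,\bar u\,E(uf)$, $f\in L^2(\mathcal{F})$, where $S=\{x: E(|u|^2)(x)\ne 0\}$ (the quotient is $0$ off $S$). A bounded operator $R$ is Cesaro bounded if the norms of the Cesaro means $A_n(R)=n^{-1}\sum_{i=0}^{n-1}R^i$, $n\ge 1$, are uniformly bounded. An empty sum is $0$ (so $v_1=0$). *)

(* Defs.v *)
From HB Require Import structures.
From mathcomp Require Export all_boot all_order all_algebra.
From mathcomp Require Export all_classical all_reals all_analysis.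
From mathcomp Require Export measurable_realfun ess_sup_inf.
From mathcomp Require Export complex.
Set Implicit Arguments.
Unset Strict Implicit.
Unset Printing Implicit Defensive.
Export Order.TTheory GRing.Theory Num.Theory.
Export numFieldNormedType.Exports.
Export ComplexField.Normc.
Local Open Scope classical_set_scope.
Local Open Scope ring_scope.

(* Functions are everywhere-defined representatives of their a.e.-classes.
   The operators below depend on the choice of versions of conditional
   expectations only up to mu-null sets, and map a.e.-equal functions to
   a.e.-equal functions; norms do not see null sets. *)

Section complex_functions.
Context d (X : measurableType d) (R : realType).
Variable mu : {measure set X -> \bar R}.

Definition cmeasurable (f : X -> R[i]) : Prop :=
  measurable_fun setT (fun x => complex.Re (f x)) /\
  measurable_fun setT (fun x => complex.Im (f x)).

Definition L2norm (f : X -> R[i]) : \bar R :=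
  Lnorm mu 2%:E (fun x => (normc (f x))%:E).

Definition L2 (f : X -> R[i]) : Prop :=
  cmeasurable f /\ (L2norm f < +oo)%E.

Definition opnorm (T : (X -> R[i]) -> (X -> R[i])) : \bar R :=
  ereal_sup [set L2norm (T f) | f in [set f | L2 f /\ (L2norm f <= 1)%E]].

Definition bounded_op (T : (X -> R[i]) -> (X -> R[i])) : Prop :=
  (forall f, L2 f -> L2 (T f)) /\ (opnorm T < +oo)%E.

Definition cesaro_mean (T : (X -> R[i]) -> (X -> R[i])) (n : nat) :
    (X -> R[i]) -> (X -> R[i]) :=
  fun f x => n%:R^-1 * \sum_(i < n) iter i T f x.

Definition cesaro_bounded (T : (X -> R[i]) -> (X -> R[i])) : Prop :=
  bounded_op T /\
  exists C : R, forall n, (0 < n)%N -> (opnorm (cesaro_mean T n) <= C%:E)%E.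

End complex_functions.

Section conditional_expectation.
Context d (X : measurableType d) (R : realType).
Variables (mu : {measure set X -> \bar R}) (A : set (set X)).

(* A is meant to be a sigma-algebra, so that the measurable sets of
   [g_sigma_algebraType A] are exactly the members of A. *)
Definition is_cond_exp (f g : X -> \bar R) : Prop :=
  [/\ measurable_fun setT (g : g_sigma_algebraType A -> \bar R),
      forall x, (0 <= g x)%E
    & forall B, A B -> (\int[mu]_(x in B) g x = \int[mu]_(x in B) f x)%E].

(* E(f) for measurable f : X -> [0, +oo] *)
Definition cond_expe (f : X -> \bar R) : X -> \bar R :=
  xget (cst 0%E) [set g | is_cond_exp f g].

Definition conditionable (f : X -> R[i]) : Prop :=
  cmeasurable f /\
  {ae mu, forall x, (cond_expe (fun y => (normc (f y))%:E) x < +oo)%E}.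

Definition cond_expr (f : X -> R) : X -> R := fun x =>
  fine (cond_expe (EFin \o f^\+) x) - fine (cond_expe (EFin \o f^\-) x).

(* E(f) for conditionable f; in this case the four nonnegative conditional
   expectations involved are a.e. finite. *)
Definition cond_exp (f : X -> R[i]) : X -> R[i] := fun x =>
  Complex (cond_expr (fun y => complex.Re (f y)) x)
          (cond_expr (fun y => complex.Im (f y)) x).

(* E(|f|^2), possibly infinite *)
Definition cond_sqr (f : X -> R[i]) : X -> \bar R :=
  cond_expe (fun y => (normc (f y) ^+ 2)%:E).

(* the weighted conditional expectation operator M_w E M_u *)
Definition wce_op (w u f : X -> R[i]) : X -> R[i] := fun x =>
  w x * cond_exp (fun y => u y * f y) x.

(* [fine] is harmless here: E(|u|^2) is a.e. finite as soon as u f is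
   conditionable for all f in L^2. *)
Definition aluthge_wce (w u f : X -> R[i]) : X -> R[i] := fun x =>
  \1_[set y | cond_sqr u y != 0%E] x * cond_exp (fun y => u y * w y) x
    / (real_complex R (fine (cond_sqr u x)))
    * conjc (u x) * cond_exp (fun y => u y * f y) x.

(* For n >= 1 the sum runs over 0 <= i <= n - 2. *)
Definition vsum (w u : X -> R[i]) (n : nat) : X -> R[i] := fun x =>
  \sum_(i < n.-1) cond_exp (fun y => u y * w y) x ^+ i.

End conditional_expectation.

(* Main.v *)
From HB Require Import structures.
From mathcomp Require Import ring lra.
Require Import Defs.
Set Implicit Arguments.
Unset Strict Implicit.
Unset Printing Implicit Defensive.
Local Open Scope classical_set_scope.
Local Open Scope ring_scope.

(** Write h for E(uw), K for E(w^2) E(u^2) with 0 * oo = 0, and v_n for the sum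
    of h^i over i < n - 1.  As h can be pulled out of E, one has
    T^(i+1) f = h^i w E(uf), so the n-th Cesaro mean of T is
    n^-1 (I + M_{v_n w} E M_u).  Cesaro boundedness is therefore a statement
    about the norms of the operators M_W E M_U for W = v_n w and U = u, and
    these are governed by the gauge E(W^2) E(U^2):

    - if the gauge is at most D, then |M_W E M_U f|^2 <= 4 D |f|^2, by the
      conditional Cauchy-Schwarz inequality ([sqint_rwce_le]);
    - if |M_W E M_U f|^2 <= D |f|^2 for all f in L^2, then the gauge is at most
      D almost everywhere ([rwce_bound_gauge_le]).  Testing on f = U 1_B, with B
      in the subalgebra, turns the bound into an inequality of integrals over
      every such B, hence into an inequality of functions.  Truncating U makes
      f square integrable, so that this also covers the points where E(U^2) is
      infinite: there it forces E(W^2) = 0.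

    The gauge of v_n w and u is v_n^2 K.  Hence T is Cesaro bounded exactly when
    v_n^2 K <= (C n)^2 almost everywhere, for all n and one C, which is the last
    of the four conditions ([cesaro_bounded_growth], [growth_cesaro_bounded],
    [vsum_gauge_Lnorm_boundedP]).

    The Aluthge transform is again of the form M_w' E M_u, with
    w' = 1_S h / E(u^2) u, and satisfies E(u w') = h and E(w'^2) E(u^2) = h^2
    ([aluthge_symbol_gauge]).  It is therefore Cesaro bounded exactly when
    v_n h <= C n.  Since h^2 <= K by Cauchy-Schwarz, this follows from the
    condition on T; since v_n <= 1 + v_n h ([geom_le1D]), it gives the
    boundedness of v_n / n.  Finally K is bounded because T is, so that the
    boundedness of v_n / n gives back the condition v_n^2 K <= (C n)^2.

    Only boundedness matters, never the value of a constant.  This is why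
    squared norms with the inequality |f + g|^2 <= 2 (|f|^2 + |g|^2) replace the
    triangle inequality, and why E of a complex function is estimated through
    its real and imaginary parts. *)

(** * Conditional expectation of nonnegative functions *)

Section ereal_limits.
Local Open Scope ereal_scope.
Context (R : realType).

(** Monotonicity is what allows e = +oo: a limit equal to 0 is then reached from
    the start. *)
Lemma nondecreasing_cvgeZr (u : nat -> R) (l : R) (e : \bar R) :
  (forall n, 0 <= u n)%R -> {homo u : m n / (m <= n)%N >-> (m <= n)%R} ->
  (EFin \o u) n @[n --> \oo] --> l%:E -> 0 <= e ->
  (u n)%:E * e @[n --> \oo] --> l%:E * e.
Proof.
move=> u0 ndu ul; case: e => [r|_|//]; first by move=> _; exact: cvgeZr.
have ul' : u n @[n --> \oo] --> l by exact: (fine_cvg ul).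
have le_ul n : (u n <= l)%R.
  rewrite -(cvg_lim (@Rhausdorff R) ul').
  by apply: nondecreasing_cvgn_le => //; exact: cvgP ul'.
have : (0 <= l)%R by exact: le_trans (le_ul 0%N).
rewrite le_eqVlt => /predU1P[l0|l0].
  have -> : u = cst 0%R.
    by apply/funext => n; apply/eqP; rewrite eq_le u0 l0 le_ul.
  by rewrite -l0; under eq_fun do rewrite mul0e; rewrite mul0e; exact: cvg_cst.
rewrite gt0_muley// ?lte_fin//.
have [N _ uN] : \forall n \near \oo, (0 < u n)%R.
  exact: (cvgr_gt _ ul').
apply: (cvg_trans (near_eq_cvg _) (cvg_cst +oo)).
by exists N => // n /uN un0; rewrite gt0_muley// lte_fin.
Qed.

End ereal_limits.

Section sub_sigma_algebra.
Local Open Scope ereal_scope.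
Context d (X : measurableType d) (R : realType).
Variables (mu : {measure set X -> \bar R}) (A : set (set X)).
Hypotheses (A_sigma : sigma_algebra [set: X] A) (A_sub : A `<=` measurable).

Local Notation XA := (g_sigma_algebraType A).

Lemma measurable_subE (B : set X) : (measurable : set (set XA)) B <-> A B.
Proof. by rewrite measurable_g_measurableTypeE. Qed.

Lemma sub_measurable_id : measurable_fun setT (idfun : X -> XA).
Proof. by move=> _ B /measurable_subE/A_sub mB; rewrite setTI. Qed.

Lemma sub_measurable_fun d' (Y : measurableType d') (f : X -> Y) :
  measurable_fun setT (f : XA -> Y) -> measurable_fun setT f.
Proof. by move=> mf; exact: (measurableT_comp mf sub_measurable_id). Qed.

Import HBNNSimple.

(** Both sides are linear and continuous along increasing sequences in g, and
    for g an indicator of a set of A the equality is the hypothesis. *)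
Lemma eq_integral_pullout (e f : X -> \bar R) (g : X -> R) :
  measurable_fun setT e -> measurable_fun setT f ->
  (forall x, 0 <= e x) -> (forall x, 0 <= f x) ->
  (forall B, A B -> \int[mu]_(x in B) e x = \int[mu]_(x in B) f x) ->
  measurable_fun setT (g : XA -> R) -> (forall x, 0 <= g x)%R ->
  forall B, A B ->
  \int[mu]_(x in B) ((g x)%:E * e x) = \int[mu]_(x in B) ((g x)%:E * f x).
Proof.
move=> me mf e0 f0 ef mg g0 B AB.
have mB : measurable B by exact: A_sub.
have mgE : measurable_fun setT (EFin \o g : XA -> \bar R).
  exact/measurable_EFinP.
pose h : {nnsfun XA >-> R}^nat := nnsfun_approx measurableT mgE.
have hX n (y : R) : measurable ((h n : X -> R) @^-1` [set y]).
  apply: A_sub; apply/measurable_subE.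
  rewrite -[X in measurable X]setTI.
  exact: (measurable_funP (h n)).
have mh n : measurable_fun setT (h n : X -> R).
  by apply: sub_measurable_fun; exact: measurable_funP.
have nd_h m n x : (m <= n)%N -> (h m x <= h n x)%R.
  by move=> mn; apply/lefP/nd_nnsfun_approx.
have lim_h (k : X -> \bar R) : measurable_fun setT k -> (forall x, 0 <= k x) ->
    \int[mu]_(x in B) ((g x)%:E * k x) =
    limn (fun n => \int[mu]_(x in B) ((h n x)%:E * k x)).
  move=> mk k0; rewrite -monotone_convergence//.
  - apply: eq_integral => x _; apply/esym/cvg_lim => //.
    apply: nondecreasing_cvgeZr => //.
    + by move=> m n mn; exact: nd_h.
    + apply: (@cvg_nnsfun_approx _ _ _ _ measurableT _ mgE _ x) => // y _.
      by rewrite lee_fin.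
  - move=> n; apply: measurable_funTS; apply: emeasurable_funM => //.
    exact/measurable_EFinP.
  - by move=> n x _; rewrite mule_ge0// lee_fin.
  - move=> x _ m n mn; rewrite lee_wpmul2r// lee_fin.
    exact: nd_h.
rewrite !lim_h//; congr (limn _); apply/funext => n.
have key (k : X -> \bar R) : measurable_fun setT k -> (forall x, 0 <= k x) ->
    \int[mu]_(x in B) ((h n x)%:E * k x) =
    \sum_(y \in range (h n))
      (y%:E * \int[mu]_(x in B `&` (h n @^-1` [set y])) k x).
  move=> mk k0.
  transitivity (\int[mu]_(x in B) (\sum_(y \in range (h n))
    (y * \1_(h n @^-1` [set y]) x)%:E * k x)).
    apply: eq_integral => x xB.
    rewrite -ge0_mule_fsuml => [|y]; last exact: nnfun_muleindic_ge0.
    rewrite fsumEFin//; congr (_%:E * _).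
    exact: (fimfunE (h n : {nnsfun XA >-> R}) x).
  have mind y : measurable_fun setT (\1_(h n @^-1` [set y]) : X -> R).
    exact: measurable_indic.
  rewrite ge0_integral_fsum//; last 2 first.
  - move=> y; apply: measurable_funTS; apply: emeasurable_funM => //.
    by apply/measurable_EFinP; exact: measurable_funM.
  - by move=> m y Ey; rewrite mule_ge0 ?k0// nnfun_muleindic_ge0.
  apply: eq_fsbigr => r rhn.
  under eq_integral do rewrite EFinM -muleA.
  rewrite ge0_integralZl//.
  - congr (_ * _).
    rewrite integral_mkcondr; apply: eq_integral => x _.
    by rewrite epatch_indic muleC.
  - apply: measurable_funTS; apply: emeasurable_funM => //.
    exact/measurable_EFinP.
  - by move=> t Et; rewrite mule_ge0 ?lee_fin ?k0.
  - by move: rhn; rewrite inE => -[t _ <-]; rewrite lee_fin.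
rewrite !key//; apply: eq_fsbigr => r _; congr (_ * _).
apply: ef; apply/measurable_subE; apply: measurableI.
  exact/measurable_subE.
rewrite -[X in measurable X]setTI.
exact: (measurable_funP (h n)).
Qed.

End sub_sigma_algebra.

Section radon_nikodym_sub.
Local Open Scope ereal_scope.
Context d (X : measurableType d) (R : realType).
Variables (mu : {measure set X -> \bar R}) (A : set (set X)).
Hypotheses (A_sigma : sigma_algebra [set: X] A) (A_sub : A `<=` measurable).
Hypothesis A_sfinite : @sigma_finite _ (g_sigma_algebraType A) R setT mu.

Local Notation XA := (g_sigma_algebraType A).

(** The restriction of mu to A and the set function with density f, as measures
    on the smaller measurable space, where the Radon-Nikodym theorem is
    applied. *)
Let restr (B : set XA) : \bar R := mu B.

Let meas_sub (B : set XA) : measurable B -> d.-measurable (B : set X).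
Proof. by move=> /(measurable_subE A_sigma) /A_sub. Qed.

Let restr0 : restr set0 = 0. Proof. exact: measure0. Qed.
Let restr_ge0 B : 0 <= restr B. Proof. exact: measure_ge0. Qed.
Let restr_sigma_additive : semi_sigma_additive restr.
Proof.
move=> F mF tF mUF; apply: measure_semi_sigma_additive => //.
- by move=> n; exact: meas_sub.
- exact: meas_sub.
Qed.

HB.instance Definition _ := isMeasure.Build _ _ _ restr
  restr0 restr_ge0 restr_sigma_additive.

HB.instance Definition _ := Measure_isSigmaFinite.Build _ _ _ restr A_sfinite.

Lemma sub_sigma_finite_exhaustion : exists F : (set X)^nat,
  [/\ \bigcup_i F i = setT, nondecreasing_seq F, forall i, A (F i) &
      forall i, mu (F i) < +oo].
Proof.
have /sigma_finiteP[F [FT ndF mF]] := sigma_finiteT restr.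
exists F; split => // i; last exact: (mF i).2.
by apply/(measurable_subE A_sigma); exact: (mF i).1.
Qed.

Variable f : X -> R.
Hypotheses (mf : measurable_fun setT f) (f0 : forall x, (0 <= f x)%R).
Hypothesis f_fin : \int[mu]_x (f x)%:E < +oo.

Let dens (B : set XA) : \bar R := \int[mu]_(x in (B : set X)) (f x)%:E.
Let mEf : measurable_fun setT (EFin \o f). Proof. exact/measurable_EFinP. Qed.

Let dens0 : dens set0 = 0. Proof. exact: integral_set0. Qed.
Let dens_ge0 B : 0 <= dens B.
Proof. by apply: integral_ge0 => x _; rewrite lee_fin. Qed.
Let dens_sigma_additive : semi_sigma_additive dens.
Proof.
move=> F mF tF mUF; rewrite /dens ge0_integral_bigcup//.
- apply: is_cvg_ereal_nneg_natsum_cond => n _ _.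
  by apply: integral_ge0 => /= x ?; rewrite lee_fin.
- by move=> k; exact: meas_sub.
- exact: measurable_funTS.
- by move=> x _; rewrite lee_fin.
Qed.

HB.instance Definition _ := isMeasure.Build _ _ _ dens
  dens0 dens_ge0 dens_sigma_additive.

Let dens_fin : fin_num_fun dens.
Proof.
move=> B mB; rewrite ge0_fin_numE//; apply: le_lt_trans f_fin.
apply: ge0_subset_integral => //; first exact: meas_sub.
by move=> x _; rewrite lee_fin.
Qed.

HB.instance Definition _ := Measure_isFinite.Build _ _ _ dens dens_fin.

Let dens_dominated : dens `<< restr.
Proof.
apply/null_content_dominatesP => B mB B0.
apply: null_set_integral.
- exact: meas_sub.
- exact: measurable_funTS.
- exact: B0.
Qed.

(** The density of dens with respect to restr is a version of E f. *)
Lemma radon_nikodym_sub : exists g : X -> \bar R, is_cond_exp mu A (EFin \o f) g.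
Proof.
have [g [g0 gfin gint gE]] :=
  @radon_nikodym_sigma_finite _ XA R restr dens dens_dominated.
exists g; split => //; first exact: measurable_int gint.
move=> B AB.
have mB : measurable (B : set XA) by exact/measurable_subE.
rewrite -[RHS]/(dens B) gE//.
rewrite -[RHS]/(\int[pushforward mu (idfun : X -> XA)]_(x in B) g x).
rewrite (ge0_integral_pushforward (sub_measurable_id A_sigma A_sub))//.
by apply: measurable_funTS; exact: measurable_int gint.
Qed.

End radon_nikodym_sub.

Section conditional_expectation_theory.
Local Open Scope ereal_scope.
Context d (X : measurableType d) (R : realType).
Variables (mu : {measure set X -> \bar R}) (A : set (set X)).
Hypotheses (A_sigma : sigma_algebra [set: X] A) (A_sub : A `<=` measurable).
Hypothesis A_sfinite : @sigma_finite _ (g_sigma_algebraType A) R setT mu.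

Local Notation XA := (g_sigma_algebraType A).
Local Notation E := (cond_expe mu A).

(** When f is not integrable, E f can be infinite.  It is built from the
    integrable case: f is the sum of its restrictions to countably many disjoint
    sets on which it is bounded and which have finite measure, and the
    Radon-Nikodym derivatives of the pieces add up to a version of E f. *)
Lemma cond_expeP (f : X -> R) :
  measurable_fun setT f -> (forall x, (0 <= f x)%R) ->
  is_cond_exp mu A (EFin \o f) (E (EFin \o f)).
Proof.
move=> mf f0; rewrite /cond_expe.
suff [g] : [set g | is_cond_exp mu A (EFin \o f) g] !=set0.
  by move=> gE; apply: (@xgetPex _ (cst 0) [set g | is_cond_exp mu A (EFin \o f) g]);
     exists g.
have [F [FT ndF AF Ffin]] := sub_sigma_finite_exhaustion A_sigma A_sub A_sfinite.
pose G k := F k `&` [set x | (f x <= k%:R)%R].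
have mF k : measurable (F k) by exact: A_sub.
have mG k : measurable (G k).
  apply: measurableI => //.
  rewrite -[X in measurable X]setTI.
  have := @emeasurable_fun_infty_c _ X R setT (EFin \o f) measurableT.
  by move=> /(_ _ k%:R%:E); apply; exact/measurable_EFinP.
pose D := seqDU G.
have mD k : measurable (D k) by exact: seqDU_measurable.
have UD : \bigcup_k D k = setT.
  rewrite -seqDU_bigcup_eq -subTset => x _.
  have : (\bigcup_i F i) x by rewrite FT.
  move=> [n _ Fnx]; exists (maxn n (Num.bound (f x))) => //; split.
    by have /subsetPset sFF := ndF _ _ (leq_maxl n (Num.bound (f x))); exact: sFF.
  rewrite /= (le_trans (ltW (archi_boundP (f0 x))))// ler_nat.
  exact: leq_maxr.
pose p k x := (f x * \1_(D k) x)%R.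
have mp k : measurable_fun setT (p k).
  by apply: measurable_funM => //; exact: measurable_indic.
have p0 k x : (0 <= p k x)%R by rewrite mulr_ge0.
have pfin k : \int[mu]_x (p k x)%:E < +oo.
  apply: (@le_lt_trans _ _ (\int[mu]_(x in F k) (k%:R)%:E)); last first.
    by rewrite integral_cst// lte_mul_pinfty ?lee_fin.
  rewrite [leRHS]integral_mkcond; apply: ge0_le_integral => //.
  - by move=> x _; rewrite lee_fin.
  - exact/measurable_EFinP.
  - by apply/(measurable_restrictT _ _).1.
  - move=> x _; rewrite /p indicE patchE; have [xD|xD] := boolP (x \in D k).
      have [Fx fx] : G k x by apply: subset_seqDU; exact: set_mem.
      by rewrite mem_set// mulr1 lee_fin.
    by rewrite mulr0; case: ifPn => // _; rewrite lee_fin.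
have /choice[g gE] k : exists g, is_cond_exp mu A (EFin \o p k) g.
  exact: (radon_nikodym_sub A_sigma A_sub A_sfinite (mp k) (p0 k) (pfin k)).
exists (fun x => \sum_(k <oo) g k x); split.
- apply: ge0_emeasurable_sum => [k x _ _|k _]; by have [] := gE k.
- by move=> x; apply: nneseries_ge0 => n _ _; have [] := gE n.
- move=> B AB; have mB : measurable B by exact: A_sub.
  rewrite integral_nneseries//; last 2 first.
  + move=> n; apply: measurable_funTS; apply: (sub_measurable_fun A_sigma A_sub).
    by have [] := gE n.
  + by move=> n x _; have [] := gE n.
  rewrite -[in RHS](setIT B) -UD setI_bigcupr ge0_integral_bigcup//.
  + apply: eq_eseriesr => n _; have [_ _ ->//] := gE n.
    rewrite [RHS]integral_mkcondr; apply: eq_integral => x _.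
    by rewrite epatch_indic.
  + by move=> k; exact: measurableI.
  + by apply: measurable_funTS; exact/measurable_EFinP.
  + by move=> x _; rewrite lee_fin.
  + exact/trivIset_setIl/trivIset_seqDU.
Qed.

(** This turns integral inequalities over the sets of A into inequalities
    between functions.  The set where g > g' is a countable union of sets B of
    finite measure on which g' is bounded and g >= g' + c for a constant c > 0,
    and then c * mu B <= 0. *)
Lemma le_integral_ae_le (g g' : X -> \bar R) :
  measurable_fun setT (g : XA -> \bar R) ->
  measurable_fun setT (g' : XA -> \bar R) ->
  (forall x, 0 <= g x) -> (forall x, 0 <= g' x) ->
  (forall B, A B -> \int[mu]_(x in B) g x <= \int[mu]_(x in B) g' x) ->
  {ae mu, forall x, g x <= g' x}.
Proof.
move=> mg mg' g0 g'0 le_gg'.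
have [F [FT ndF AF Ffin]] := sub_sigma_finite_exhaustion A_sigma A_sub A_sfinite.
(* One index k gives both the bound on g' and the gap between g' and g. *)
pose c k : R := (k.+1%:R^-1)%R.
pose B n k := F n `&` ([set x | g' x <= k%:R%:E] `&`
                       [set x | 0 <= g x - (g' x + (c k)%:E)]).
have AB n k : A (B n k).
  apply/(measurable_subE A_sigma); apply: measurableI.
    exact/(measurable_subE A_sigma).
  apply: measurableI.
    rewrite -[X in measurable X]setTI.
    exact: (@emeasurable_fun_infty_c _ XA).
  rewrite -[X in measurable X]setTI.
  apply: (@emeasurable_fun_c_infty _ XA) => //.
  by apply: emeasurable_funB => //; exact: emeasurable_funD.
have mB n k : measurable (B n k) by exact: A_sub.
have mgX := sub_measurable_fun A_sigma A_sub mg.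
have mg'X := sub_measurable_fun A_sigma A_sub mg'.
have muB n k : mu (B n k) = 0.
  have c0 : (0 < c k)%R by rewrite invr_gt0.
  have Bfin : mu (B n k) < +oo.
    apply: le_lt_trans (Ffin n); apply: le_measure; rewrite ?inE//.
      exact: A_sub.
    by move=> x [].
  have g'fin : \int[mu]_(x in B n k) g' x < +oo.
    apply: (@le_lt_trans _ _ (\int[mu]_(x in B n k) (k%:R)%:E)); last first.
      by rewrite integral_cst// lte_mul_pinfty ?lee_fin.
    apply: ge0_le_integral => //; first exact: measurable_funTS.
    by move=> x [_ []].
  have : \int[mu]_(x in B n k) (g' x + (c k)%:E) <= \int[mu]_(x in B n k) g' x.
    apply: le_trans (le_gg' _ (AB n k)).
    apply: ge0_le_integral => //.
    - by move=> x _; rewrite adde_ge0// lee_fin ltW.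
    - by apply: measurable_funTS; exact: emeasurable_funD.
    - exact: measurable_funTS.
    - move=> x [_ [/= g'k]]; rewrite sube_ge0// fin_numD/= andbT.
      by rewrite ge0_fin_numE// (le_lt_trans g'k)// ltry.
  rewrite ge0_integralD//; last 2 first.
    exact: measurable_funTS.
    by move=> x _; rewrite lee_fin ltW.
  rewrite integral_cst// -[leRHS]adde0 leeD2lE; last by rewrite ge0_fin_numE// integral_ge0.
  rewrite pmule_rle0 ?lte_fin// => muB0.
  by apply/eqP; rewrite eq_le muB0 measure_ge0.
have : {ae mu, forall x, forall n k, ~ B n k x}.
  apply: ae_foralln => n; apply: ae_foralln => k.
  exists (B n k); split => // x /=; exact: contrapT.
apply: filterS => x nB; rewrite leNgt; apply/negP => lt_g'g.
have : (\bigcup_i F i) x by rewrite FT.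
move=> [n _ Fnx].
have g'fin : g' x \is a fin_num.
  by rewrite ge0_fin_numE// (lt_le_trans lt_g'g)// leey.
have [k [le_g'k le_g]] : exists k, g' x <= k%:R%:E /\ g' x + (c k)%:E <= g x.
  move: g'fin lt_g'g (g'0 x); case: (g' x) => //= r _.
  case: (g x) => [s||]//.
  - rewrite lte_fin lee_fin => rs r0.
    near \oo => k; exists k; rewrite !lee_fin; split.
      near: k; exact: nbhs_infty_ger.
    rewrite addrC -lerBrDr ltW//; near: k.
    by apply: near_infty_natSinv_lt (PosNum (_ : 0 < s - r)%R); rewrite subr_gt0.
  - move=> _ r0; exists (Num.bound r); rewrite leey; split => //.
    by rewrite lee_fin ltW// archi_boundP.
apply: (nB n k); split => //; split => //=.
rewrite sube_ge0// fin_numD g'fin//.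
Unshelve. all: end_near. Qed.
End conditional_expectation_theory.

Section conditional_expectation_algebra.
Local Open Scope ereal_scope.
Context d (X : measurableType d) (R : realType).
Variables (mu : {measure set X -> \bar R}) (A : set (set X)).
Hypotheses (A_sigma : sigma_algebra [set: X] A) (A_sub : A `<=` measurable).
Hypothesis A_sfinite : @sigma_finite _ (g_sigma_algebraType A) R setT mu.

Local Notation XA := (g_sigma_algebraType A).
Local Notation E f := (cond_expe mu A (EFin \o f)).

(** True of any f, because the default value of [cond_expe] is 0. *)
Lemma cond_expe_measurable_ge0 (f : X -> \bar R) :
  measurable_fun setT (cond_expe mu A f : XA -> \bar R) /\
  forall x, 0 <= cond_expe mu A f x.
Proof.
rewrite /cond_expe; case: xgetP => [g _ []//|_]; split => //.
Qed.

Lemma cond_expe_sub_measurable (f : X -> \bar R) :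
  measurable_fun setT (cond_expe mu A f : XA -> \bar R).
Proof. exact: (cond_expe_measurable_ge0 f).1. Qed.

Lemma cond_expe_ge0 (f : X -> \bar R) x : 0 <= cond_expe mu A f x.
Proof. exact: (cond_expe_measurable_ge0 f).2. Qed.

Lemma cond_expe_measurable (f : X -> \bar R) :
  measurable_fun setT (cond_expe mu A f).
Proof.
exact: (sub_measurable_fun A_sigma A_sub (cond_expe_sub_measurable f)).
Qed.

Lemma integral_cond_expe (f : X -> R) (B : set X) :
  measurable_fun setT f -> (forall x, (0 <= f x)%R) -> A B ->
  \int[mu]_(x in B) E f x = \int[mu]_(x in B) (f x)%:E.
Proof. by move=> mf f0; have [_ _] := cond_expeP A_sigma A_sub A_sfinite mf f0; apply. Qed.

(** An equality of functions, not only almost everywhere: f and g have the same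
    versions of the conditional expectation, among which the same one is
    chosen. *)
Lemma eq_ae_cond_expe (f g : X -> R) :
  measurable_fun setT f -> (forall x, (0 <= f x)%R) ->
  measurable_fun setT g -> (forall x, (0 <= g x)%R) ->
  {ae mu, forall x, f x = g x} -> E f = E g.
Proof.
move=> mf f0 mg g0 fg; rewrite /cond_expe; congr (xget _ _).
have fgB B : A B -> \int[mu]_(x in B) (f x)%:E = \int[mu]_(x in B) (g x)%:E.
  move=> AB; apply: ge0_ae_eq_integral.
  - exact: A_sub.
  - by apply: measurable_funTS; exact/measurable_EFinP.
  - by apply: measurable_funTS; exact/measurable_EFinP.
  - by move=> x _; rewrite lee_fin.
  - by move=> x _; rewrite lee_fin.
  - by apply: filterS fg => x -> _.
by apply/seteqP; split => k [mk k0 kE]; split => // B AB; rewrite kE//= fgB.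
Qed.

Lemma le_cond_expe (f g : X -> R) :
  measurable_fun setT f -> (forall x, (0 <= f x)%R) ->
  measurable_fun setT g -> (forall x, (0 <= g x)%R) ->
  {ae mu, forall x, (f x <= g x)%R} -> {ae mu, forall x, E f x <= E g x}.
Proof.
move=> mf f0 mg g0 fg.
apply: (le_integral_ae_le A_sigma A_sub A_sfinite).
- exact: cond_expe_sub_measurable.
- exact: cond_expe_sub_measurable.
- exact: cond_expe_ge0.
- exact: cond_expe_ge0.
- move=> B AB; rewrite !integral_cond_expe//; apply: ae_ge0_le_integral.
  - exact: A_sub.
  - by move=> x _; rewrite lee_fin.
  - by apply: measurable_funTS; exact/measurable_EFinP.
  - by move=> x _; rewrite lee_fin.
  - by apply: measurable_funTS; exact/measurable_EFinP.
  - by apply: filterS fg => x fgx _; rewrite lee_fin.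
Qed.

Lemma cond_expe_unique (f : X -> R) (g : X -> \bar R) :
  measurable_fun setT f -> (forall x, (0 <= f x)%R) ->
  is_cond_exp mu A (EFin \o f) g -> {ae mu, forall x, E f x = g x}.
Proof.
move=> mf f0 [mg g0 gE].
have le1 : {ae mu, forall x, E f x <= g x}.
  apply: (le_integral_ae_le A_sigma A_sub A_sfinite) => //.
  - exact: cond_expe_sub_measurable.
  - exact: cond_expe_ge0.
  - by move=> B AB; rewrite integral_cond_expe// gE.
have le2 : {ae mu, forall x, g x <= E f x}.
  apply: (le_integral_ae_le A_sigma A_sub A_sfinite) => //.
  - exact: cond_expe_sub_measurable.
  - exact: cond_expe_ge0.
  - by move=> B AB; rewrite integral_cond_expe// gE.
by apply: filterS2 le1 le2 => x h1 h2; apply/eqP; rewrite eq_le h1 h2.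
Qed.

Lemma cond_expeD (f g : X -> R) :
  measurable_fun setT f -> (forall x, (0 <= f x)%R) ->
  measurable_fun setT g -> (forall x, (0 <= g x)%R) ->
  {ae mu, forall x, E (f \+ g)%R x = E f x + E g x}.
Proof.
move=> mf f0 mg g0; apply: cond_expe_unique.
- exact: measurable_funD.
- by move=> x; rewrite addr_ge0.
split.
- by apply: emeasurable_funD; exact: cond_expe_sub_measurable.
- by move=> x; rewrite adde_ge0// cond_expe_ge0.
- move=> B AB; rewrite ge0_integralD//; last 5 first.
  + exact: A_sub.
  + by move=> x _; exact: cond_expe_ge0.
  + by apply: measurable_funTS; exact: cond_expe_measurable.
  + by move=> x _; exact: cond_expe_ge0.
  + by apply: measurable_funTS; exact: cond_expe_measurable.
  rewrite !integral_cond_expe// -ge0_integralD//.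
  + exact: A_sub.
  + by move=> x _; rewrite lee_fin.
  + by apply: measurable_funTS; exact/measurable_EFinP.
  + by move=> x _; rewrite lee_fin.
  + by apply: measurable_funTS; exact/measurable_EFinP.
Qed.

Lemma cond_expe_pullout (g f : X -> R) :
  measurable_fun setT (g : XA -> R) -> (forall x, (0 <= g x)%R) ->
  measurable_fun setT f -> (forall x, (0 <= f x)%R) ->
  {ae mu, forall x, E (g \* f)%R x = (g x)%:E * E f x}.
Proof.
move=> mg g0 mf f0.
have mgX := sub_measurable_fun A_sigma A_sub mg.
apply: cond_expe_unique.
- exact: measurable_funM.
- by move=> x; rewrite mulr_ge0.
split.
- apply: emeasurable_funM; last exact: cond_expe_sub_measurable.
  exact/measurable_EFinP.
- by move=> x; rewrite mule_ge0 ?lee_fin// cond_expe_ge0.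
- move=> B AB.
  rewrite (eq_integral_pullout (f := EFin \o f) A_sigma A_sub)//.
  + exact: cond_expe_measurable.
  + exact/measurable_EFinP.
  + exact: cond_expe_ge0.
  + by move=> C AC; rewrite integral_cond_expe.
Qed.

Lemma integral_pullout (g f : X -> R) :
  measurable_fun setT (g : XA -> R) -> (forall x, (0 <= g x)%R) ->
  measurable_fun setT f -> (forall x, (0 <= f x)%R) ->
  forall B, A B -> \int[mu]_(x in B) ((g x)%:E * E f x) =
                   \int[mu]_(x in B) (g x * f x)%:E.
Proof.
move=> mg g0 mf f0 B AB.
rewrite (eq_integral_pullout (f := EFin \o f) A_sigma A_sub)//.
+ exact: cond_expe_measurable.
+ exact/measurable_EFinP.
+ exact: cond_expe_ge0.
+ by move=> C AC; rewrite integral_cond_expe.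
Qed.

Lemma sub_setT : A setT.
Proof. by apply/(measurable_subE A_sigma); exact: measurableT. Qed.

Lemma cond_expe_eq0 (f : X -> R) :
  measurable_fun setT f -> (forall x, (0 <= f x)%R) ->
  {ae mu, forall x, E f x = 0} <-> {ae mu, forall x, f x = 0%R}.
Proof.
move=> mf f0.
have mEf : measurable_fun setT (EFin \o f) by exact/measurable_EFinP.
have e : \int[mu]_x `|E f x| = \int[mu]_x `|(EFin \o f) x|.
  rewrite (eq_integral (E f)); last by move=> x _; rewrite gee0_abs// cond_expe_ge0.
  rewrite [RHS](eq_integral (EFin \o f)); last first.
    by move=> x _; rewrite gee0_abs//= lee_fin.
  by rewrite integral_cond_expe//; exact: sub_setT.
split => h.
  have : ae_eq mu setT (EFin \o f) (cst 0).
    apply/ae_eq_integral_abs => //; rewrite -e.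
    apply/ae_eq_integral_abs => //; first exact: cond_expe_measurable.
    by apply: filterS h => x + _.
  by apply: filterS => x /(_ I) [].
have : ae_eq mu setT (E f) (cst 0).
  apply/ae_eq_integral_abs => //; first exact: cond_expe_measurable.
  rewrite e; apply/ae_eq_integral_abs => //.
  by apply: filterS h => x /= -> _.
by apply: filterS => x /(_ I).
Qed.

Lemma sub_preimage_eq (g : X -> \bar R) (y : \bar R) :
  measurable_fun setT (g : XA -> \bar R) -> A [set x | g x = y].
Proof.
move=> mg; apply/(measurable_subE A_sigma).
rewrite -[X in measurable X]setTI.
exact: (mg measurableT [set y] (emeasurable_set1 y)).
Qed.

(** The set B where E f = 0 belongs to A, so E (1_B f) = 1_B E f = 0.  Hence
    1_B f = 0, then 1_B g = 0, and 1_B E g = 0. *)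
Lemma cond_expe_support (f g : X -> R) :
  measurable_fun setT f -> (forall x, (0 <= f x)%R) ->
  measurable_fun setT g -> (forall x, (0 <= g x)%R) ->
  (forall x, f x = 0%R -> g x = 0%R) ->
  {ae mu, forall x, E f x = 0 -> E g x = 0}.
Proof.
move=> mf f0 mg g0 fg.
pose B := [set x | E f x = 0].
have AB : A B by apply: sub_preimage_eq; exact: cond_expe_sub_measurable.
pose i : X -> R := \1_B.
have mi : measurable_fun setT (i : XA -> R).
  by apply: measurable_indic; exact/(measurable_subE A_sigma).
have miX := sub_measurable_fun A_sigma A_sub mi.
have i0 x : (0 <= i x)%R by [].
have if0 : {ae mu, forall x, (i \* f)%R x = 0%R}.
  apply/cond_expe_eq0.
  - exact: measurable_funM.
  - by move=> x; rewrite mulr_ge0.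
  apply: filterS (cond_expe_pullout mi i0 mf f0) => x ->.
  rewrite /i indicE; have [/set_mem ->|_] := boolP (x \in B).
    by rewrite mule0.
  by rewrite mul0e.
have /cond_expe_eq0 : {ae mu, forall x, (i \* g)%R x = 0%R}.
  apply: filterS if0 => x /= /eqP; rewrite mulf_eq0 => /orP[/eqP->|/eqP/fg->].
    by rewrite mul0r.
  by rewrite mulr0.
have mig : measurable_fun setT (i \* g)%R by exact: measurable_funM.
have ig0 x : (0 <= (i \* g) x)%R by rewrite mulr_ge0.
move=> /(_ mig ig0).
apply: filterS2 (cond_expe_pullout mi i0 mg g0) => x -> + Bx.
by rewrite /i indicE mem_set// mul1e.
Qed.

Lemma measurable_sqrtr : measurable_fun setT (@Num.sqrt R).
Proof. by apply: continuous_measurable_fun; exact: sqrt_continuous. Qed.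

(** With a and b the square roots of E(p^2) and E(q^2), the inequality
    2 a b p q <= b^2 p^2 + a^2 q^2 gives 2 a b E(pq) <= 2 a^2 b^2, because a and
    b can be pulled out of E; dividing by a b is possible where both are finite
    and nonzero.  Where one of them vanishes so does E(pq)
    ([cond_expe_support]), which also settles the products 0 * oo. *)
Lemma cond_expe_cauchy_schwarz (p q : X -> R) :
  measurable_fun setT p -> (forall x, (0 <= p x)%R) ->
  measurable_fun setT q -> (forall x, (0 <= q x)%R) ->
  {ae mu, forall x, E (p \* q)%R x * E (p \* q)%R x <=
                    E (p \* p)%R x * E (q \* q)%R x}.
Proof.
move=> mp p0 mq q0.
have mpp : measurable_fun setT (p \* p)%R by exact: measurable_funM.
have mqq : measurable_fun setT (q \* q)%R by exact: measurable_funM.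
have mpq : measurable_fun setT (p \* q)%R by exact: measurable_funM.
have pp0 x : (0 <= (p \* p) x)%R by rewrite mulr_ge0.
have qq0 x : (0 <= (q \* q) x)%R by rewrite mulr_ge0.
have pq0 x : (0 <= (p \* q) x)%R by rewrite mulr_ge0.
pose al x := Num.sqrt (fine (E (p \* p)%R x)).
pose be x := Num.sqrt (fine (E (q \* q)%R x)).
have msqrt (f : X -> R) : measurable_fun setT
    ((fun x => Num.sqrt (fine (E f x))) : XA -> R).
  apply: (measurableT_comp measurable_sqrtr).
  by apply: (measurableT_comp (fine_measurable measurableT));
    exact: cond_expe_sub_measurable.
have mal : measurable_fun setT (al : XA -> R) by exact: msqrt.
have mbe : measurable_fun setT (be : XA -> R) by exact: msqrt.
have al0 x : (0 <= al x)%R by exact: sqrtr_ge0.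
have be0 x : (0 <= be x)%R by exact: sqrtr_ge0.
have mab : measurable_fun setT ((2 \o* (al \* be))%R : XA -> R).
  by apply: measurable_funM => //; exact: measurable_funM.
have maa : measurable_fun setT ((al \* al)%R : XA -> R) by exact: measurable_funM.
have mbb : measurable_fun setT ((be \* be)%R : XA -> R) by exact: measurable_funM.
have ab0 x : (0 <= (2 \o* (al \* be)) x)%R by rewrite !mulr_ge0.
have aa0 x : (0 <= (al \* al) x)%R by rewrite mulr_ge0.
have bb0 x : (0 <= (be \* be) x)%R by rewrite mulr_ge0.
have mX (f : X -> R) : measurable_fun setT (f : XA -> R) -> measurable_fun setT f.
  by move=> mf; exact: (sub_measurable_fun A_sigma A_sub mf).
have le1 : {ae mu, forall x, E ((2 \o* (al \* be)) \* (p \* q))%R x <=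
    E (((be \* be) \* (p \* p)) \+ ((al \* al) \* (q \* q)))%R x}.
  apply: le_cond_expe.
  - by apply: measurable_funM => //; exact: mX.
  - by move=> x; apply: mulr_ge0.
  - by apply: measurable_funD; apply: measurable_funM => //; exact: mX.
  - by move=> x; apply: addr_ge0; apply: mulr_ge0.
  - apply: aeW => x /=; rewrite -subr_ge0.
    have -> : (be x * be x * (p x * p x) + al x * al x * (q x * q x) -
      al x * be x * 2 * (p x * q x) = (be x * p x - al x * q x) ^+ 2)%R.
      ring.
    exact: sqr_ge0.
have z1 : {ae mu, forall x, E (p \* p)%R x = 0 -> E (p \* q)%R x = 0}.
  apply: cond_expe_support => // x /= /eqP; rewrite mulf_eq0 orbb => /eqP->.
  by rewrite mul0r.
have z2 : {ae mu, forall x, E (q \* q)%R x = 0 -> E (p \* q)%R x = 0}.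
  apply: cond_expe_support => // x /= /eqP; rewrite mulf_eq0 orbb => /eqP->.
  by rewrite mulr0.
have e1 := cond_expe_pullout mab ab0 mpq pq0.
have e2 := cond_expe_pullout mbb bb0 mpp pp0.
have e3 := cond_expe_pullout maa aa0 mqq qq0.
have e4 : {ae mu, forall x, E (((be \* be) \* (p \* p)) \+
   ((al \* al) \* (q \* q)))%R x = E ((be \* be) \* (p \* p))%R x +
   E ((al \* al) \* (q \* q))%R x}.
  apply: cond_expeD.
  - by apply: measurable_funM => //; exact: mX.
  - by move=> x; apply: mulr_ge0.
  - by apply: measurable_funM => //; exact: mX.
  - by move=> x; apply: mulr_ge0.
apply: filterS2 (filterI z1 z2) (filterI (filterI (filterI le1 e1) (filterI e2 e3)) e4).
move=> x [Z1 Z2] [[[L E1] [E2 E3]] E4]; move: L.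
rewrite [X in X <= _]E1 [X in _ <= X]E4 [X in _ <= X + _]E2 [X in _ <= _ + X]E3.
move: Z1 Z2 (cond_expe_ge0 (EFin \o (p \* p)%R) x)
  (cond_expe_ge0 (EFin \o (q \* q)%R) x)
  (cond_expe_ge0 (EFin \o (p \* q)%R) x).
rewrite /= /al /be.
set a := E (p \* p)%R x; set b := E (q \* q)%R x; set c := E (p \* q)%R x.
move=> Z1 Z2 a_ge0 b_ge0 c_ge0.
move=> L.
have [a0|a_neq0] := eqVneq a 0; first by rewrite Z1// a0 !mul0e.
have [b0|b_neq0] := eqVneq b 0; first by rewrite Z2// b0 !mule0.
have [->|a_neqy] := eqVneq a +oo; first by rewrite gt0_mulye ?leey// lt0e b_neq0.
have [->|b_neqy] := eqVneq b +oo; first by rewrite gt0_muley ?leey// lt0e a_neq0.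
move: a_ge0 b_ge0 c_ge0 a_neq0 b_neq0 a_neqy b_neqy L.
clear Z1 Z2; clearbody a b c; case: a => [a| |]//; case: b => [b| |]// /=.
rewrite !lee_fin !eqe => a_ge0 b_ge0 c_ge0 a_neq0 b_neq0 _ _ L.
have sa : (0 < Num.sqrt a)%R by rewrite sqrtr_gt0 lt0r a_neq0.
have sb : (0 < Num.sqrt b)%R by rewrite sqrtr_gt0 lt0r b_neq0.
have ea : (a = Num.sqrt a * Num.sqrt a)%R by rewrite -expr2 sqr_sqrtr.
have eb : (b = Num.sqrt b * Num.sqrt b)%R by rewrite -expr2 sqr_sqrtr.
move: L ea eb sa sb; move: (Num.sqrt a) (Num.sqrt b) => s t L ea eb s0 t0.
move: c_ge0 L; rewrite {}ea {}eb; case: c => [c| |]//.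
  rewrite -!EFinM -!EFinD !lee_fin => c_ge0 h.
  have lec : (c <= s * t)%R by rewrite -(ler_pM2l (mulr_gt0 s0 t0)); lra.
  by rewrite [leRHS](_ : _ = (s * t) * (s * t))%R ?ler_pM//; ring.
by rewrite gt0_muley ?lte_fin ?mulr_gt0// -!EFinM -EFinD leye_eq.
Qed.
End conditional_expectation_algebra.

(** * Complex-valued functions *)

Section complex_measurability.
Context d (X : measurableType d) (R : realType).
Implicit Types (f g : X -> R[i]) (p : X -> R).

Lemma ReM (z t : R[i]) : complex.Re (z * t) =
  complex.Re z * complex.Re t - complex.Im z * complex.Im t.
Proof. by case: z => a b; case: t. Qed.

Lemma ImM (z t : R[i]) : complex.Im (z * t) =
  complex.Re z * complex.Im t + complex.Im z * complex.Re t.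
Proof. by case: z => a b; case: t. Qed.

Lemma ReD (z t : R[i]) : complex.Re (z + t) = complex.Re z + complex.Re t.
Proof. by case: z => a b; case: t. Qed.

Lemma ImD (z t : R[i]) : complex.Im (z + t) = complex.Im z + complex.Im t.
Proof. by case: z => a b; case: t. Qed.

Lemma sqr_normcE (z : R[i]) : normc z ^+ 2 = complex.Re z ^+ 2 + complex.Im z ^+ 2.
Proof. by case: z => a b /=; rewrite sqr_sqrtr// addr_ge0// sqr_ge0. Qed.

Lemma normc_ge0 (z : R[i]) : 0 <= normc z.
Proof. by case: z => a b; exact: sqrtr_ge0. Qed.

Lemma normcR (x : R) : normc (real_complex R x) = `|x|.
Proof. by rewrite /normc /= expr0n addr0 sqrtr_sqr. Qed.

Lemma normr_Re_le (z : R[i]) : `|complex.Re z| <= normc z.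
Proof.
rewrite -[leRHS]ger0_norm ?normc_ge0// -ler_sqr ?nnegrE// -!normrX.
by rewrite !ger0_norm ?sqr_ge0// sqr_normcE lerDl sqr_ge0.
Qed.

Lemma normr_Im_le (z : R[i]) : `|complex.Im z| <= normc z.
Proof.
rewrite -[leRHS]ger0_norm ?normc_ge0// -ler_sqr ?nnegrE// -!normrX.
by rewrite !ger0_norm ?sqr_ge0// sqr_normcE lerDr sqr_ge0.
Qed.

Lemma normc_le_ReIm (z : R[i]) : normc z <= `|complex.Re z| + `|complex.Im z|.
Proof.
rewrite -ler_sqr ?nnegrE ?normc_ge0 ?addr_ge0// sqr_normcE sqrrD.
rewrite -!normrX !(ger0_norm (sqr_ge0 _)).
by rewrite addrAC lerDl mulrn_wge0// mulr_ge0.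
Qed.

Lemma cmeasurableM f g : cmeasurable f -> cmeasurable g ->
  cmeasurable (fun x => f x * g x).
Proof.
move=> [fr fi] [gr gi]; split.
- under eq_fun do rewrite ReM.
  by apply: measurable_funB; exact: measurable_funM.
- under eq_fun do rewrite ImM.
  by apply: measurable_funD; exact: measurable_funM.
Qed.

Lemma cmeasurableD f g : cmeasurable f -> cmeasurable g ->
  cmeasurable (fun x => f x + g x).
Proof.
move=> [fr fi] [gr gi]; split.
- by under eq_fun do rewrite ReD; exact: measurable_funD.
- by under eq_fun do rewrite ImD; exact: measurable_funD.
Qed.

Lemma cmeasurable_real p : measurable_fun setT p ->
  cmeasurable (fun x => real_complex R (p x)).
Proof. by move=> mp; split => //; exact: measurable_cst. Qed.

Lemma cmeasurable_sum n (f : 'I_n -> X -> R[i]) :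
  (forall i, cmeasurable (f i)) -> cmeasurable (fun x => \sum_(i < n) f i x).
Proof.
elim: n f => [|n IH] f mf.
  under eq_fun do rewrite big_ord0.
  by split; exact: measurable_cst.
under eq_fun do rewrite big_ord_recl.
by apply: cmeasurableD => //; apply: IH => i.
Qed.

Lemma measurable_normc f : cmeasurable f -> measurable_fun setT (@normc R \o f).
Proof.
move=> [fr fi].
rewrite (_ : @normc R \o f = Num.sqrt \o
  (fun x => complex.Re (f x) ^+ 2 + complex.Im (f x) ^+ 2)); last first.
  by apply/funext => x /=; rewrite -sqr_normcE sqrtr_sqr ger0_norm// normc_ge0.
apply: measurableT_comp; first exact: measurable_sqrtr.
by apply: measurable_funD; exact: measurable_funX.
Qed.

End complex_measurability.

Section complex_conditional_expectation.
Context d (X : measurableType d) (R : realType).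
Variables (mu : {measure set X -> \bar R}) (A : set (set X)).
Hypotheses (A_sigma : sigma_algebra [set: X] A) (A_sub : A `<=` measurable).
Hypothesis A_sfinite : @sigma_finite _ (g_sigma_algebraType A) R setT mu.

Local Notation XA := (g_sigma_algebraType A).
Local Notation E f := (cond_expe mu A (EFin \o f)).

Lemma cond_expr_measurable (p : X -> R) :
  measurable_fun setT (cond_expr mu A p : XA -> R).
Proof.
by apply: measurable_funB; apply: (measurableT_comp (fine_measurable measurableT));
  exact: cond_expe_sub_measurable.
Qed.

Lemma cond_exp_measurable (f : X -> R[i]) :
  @cmeasurable _ XA R (cond_exp mu A f : XA -> R[i]).
Proof. by split; exact: cond_expr_measurable. Qed.

Lemma sub_cmeasurable (f : X -> R[i]) :
  @cmeasurable _ XA R (f : XA -> R[i]) -> cmeasurable f.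
Proof.
by move=> [fr fi]; split; [exact: (sub_measurable_fun A_sigma A_sub fr)|
                           exact: (sub_measurable_fun A_sigma A_sub fi)].
Qed.

(** Equalities of functions, as for [eq_ae_cond_expe]. *)
Lemma eq_ae_cond_expr (p q : X -> R) :
  measurable_fun setT p -> measurable_fun setT q ->
  {ae mu, forall x, p x = q x} -> cond_expr mu A p = cond_expr mu A q.
Proof.
move=> mp mq pq; apply/funext => x; rewrite /cond_expr.
have pos : E p^\+ = E q^\+.
  apply: (eq_ae_cond_expe A_sub) => //.
  - exact: measurable_funrpos.
  - exact: measurable_funrpos.
  - by apply: filterS pq => y; rewrite /funrpos => ->.
have neg : E p^\- = E q^\-.
  apply: (eq_ae_cond_expe A_sub) => //.
  - exact: measurable_funrneg.
  - exact: measurable_funrneg.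
  - by apply: filterS pq => y; rewrite /funrneg => ->.
by rewrite pos neg.
Qed.

Lemma eq_ae_cond_exp (f g : X -> R[i]) : cmeasurable f -> cmeasurable g ->
  {ae mu, forall x, f x = g x} -> cond_exp mu A f = cond_exp mu A g.
Proof.
move=> [fr fi] [gr gi] fg; apply/funext => x; rewrite /cond_exp.
congr (Complex _ _).
- rewrite (eq_ae_cond_expr fr gr)//.
  by apply: filterS fg => y ->.
- rewrite (eq_ae_cond_expr fi gi)//.
  by apply: filterS fg => y ->.
Qed.

(** E(p^+) and E(p^-) are at most E q, and replacing an infinite value by 0, as
    [fine] does, can only decrease the left side. *)
Lemma cond_expr_bound (p q : X -> R) :
  measurable_fun setT p -> measurable_fun setT q ->
  (forall x, `|p x| <= q x) ->
  {ae mu, forall x, (`|cond_expr mu A p x|%:E <= E q x)%E}.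
Proof.
move=> mp mq pq.
have q0 x : 0 <= q x by exact: le_trans (pq x).
have pos : {ae mu, forall x, (E (p^\+)%R x <= E q x)%E}.
  apply: (le_cond_expe A_sigma A_sub A_sfinite) => //.
  - exact: measurable_funrpos.
  - apply: aeW => x; rewrite /funrpos ge_max q0 andbT.
    by apply: le_trans (pq x); exact: ler_norm.
have neg : {ae mu, forall x, (E (p^\-)%R x <= E q x)%E}.
  apply: (le_cond_expe A_sigma A_sub A_sfinite) => //.
  - exact: measurable_funrneg.
  - apply: aeW => x; rewrite /funrneg ge_max q0 andbT.
    by apply: le_trans (pq x); rewrite -normrN; exact: ler_norm.
apply: filterS2 pos neg => x.
rewrite /cond_expr.
move: (cond_expe_ge0 mu A (EFin \o p^\+) x) (cond_expe_ge0 mu A (EFin \o p^\-) x).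
move: (E q x) (E p^\+ x) (E p^\- x) => [c| |]; last 2 first.
- by move=> *; rewrite leey.
- by move=> [a| |] [b| |].
move=> [a| |] [b| |]//=; rewrite !lee_fin => a0 b0 ac bc.
by rewrite ler_norml; lra.
Qed.

(** The factor 2 comes from bounding the real and imaginary parts separately. *)
Lemma cond_exp_bound (f : X -> R[i]) : cmeasurable f ->
  {ae mu, forall x, ((normc (cond_exp mu A f x))%:E <=
                     2%:E * E (@normc R \o f) x)%E}.
Proof.
move=> mf; have mn := measurable_normc mf; case: (mf) => fr fi.
have h1 := cond_expr_bound fr mn (fun x => normr_Re_le (f x)).
have h2 := cond_expr_bound fi mn (fun x => normr_Im_le (f x)).
apply: filterS2 h1 h2 => x h1 h2.
apply: (@le_trans _ _ (`|cond_expr mu A (fun y => complex.Re (f y)) x|%:E +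
                       `|cond_expr mu A (fun y => complex.Im (f y)) x|%:E)%E).
  by rewrite -EFinD lee_fin; exact: normc_le_ReIm.
have -> : (2%:E * E (@normc R \o f) x = E (@normc R \o f) x + E (@normc R \o f) x)%E.
  rewrite (_ : 2%:E = 1%:E + 1%:E)%E; last by rewrite -EFinD.
  by rewrite ge0_muleDl ?mul1e ?lee_fin.
exact: leeD.
Qed.

(** The sign of p makes the positive and negative parts of p g equal to p g^+ and
    p g^-, and reduces the claim to nonnegative multipliers.  Where E p is
    infinite both sides are 0. *)
Lemma cond_expr_pullout (p g : X -> R) :
  measurable_fun setT p -> (forall x, 0 <= p x) ->
  measurable_fun setT (g : XA -> R) ->
  {ae mu, forall x, cond_expr mu A (p \* g) x = fine (E p x) * g x}.
Proof.
move=> mp p0 mg.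
have mgX := sub_measurable_fun A_sigma A_sub mg.
have mgp : measurable_fun setT (g^\+ : XA -> R) by exact: measurable_funrpos.
have mgn : measurable_fun setT (g^\- : XA -> R) by exact: measurable_funrneg.
have h1 := cond_expe_pullout A_sigma A_sub A_sfinite mgp (funrpos_ge0 g) mp p0.
have h2 := cond_expe_pullout A_sigma A_sub A_sfinite mgn (funrneg_ge0 g) mp p0.
apply: filterS2 h1 h2 => x h1 h2.
have -> : cond_expr mu A (p \* g) x =
   fine (E (g^\+ \* p) x) - fine (E (g^\- \* p) x).
  rewrite /cond_expr; congr (fine (cond_expe _ _ _ x) - fine (cond_expe _ _ _ x));
    apply/funext => y /=.
    by rewrite /funrpos maxr_pMl// mul0r mulrC.
  by rewrite /funrneg maxr_pMl// mul0r mulNr mulrC.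
have fineZ (a : R) (b : \bar R) : (0 <= b)%E -> fine (a%:E * b) = a * fine b.
  case: b => [b| |]//= _; rewrite mulr0.
  have [a0|a0|<-] := ltgtP 0 a; last by rewrite mul0e.
    by rewrite gt0_muley.
  by rewrite lt0_muley.
rewrite h1 h2 !fineZ ?cond_expe_ge0//.
rewrite -mulrBl mulrC; congr (_ * _).
by rewrite -[in RHS](funrposBneg g).
Qed.

Lemma cond_exp_pullout (p : X -> R) (g : X -> R[i]) :
  measurable_fun setT p -> (forall x, 0 <= p x) ->
  @cmeasurable _ XA R (g : XA -> R[i]) ->
  {ae mu, forall x, cond_exp mu A (fun y => real_complex R (p y) * g y) x =
                    real_complex R (fine (E p x)) * g x}.
Proof.
move=> mp p0 [gr gi].
apply: filterS2 (cond_expr_pullout mp p0 gr) (cond_expr_pullout mp p0 gi).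
move=> x h1 h2; rewrite /cond_exp.
have -> : (fun y => complex.Re (real_complex R (p y) * g y)) =
          p \* (fun y => complex.Re (g y)).
  by apply/funext => y; rewrite ReM /= mul0r subr0.
have -> : (fun y => complex.Im (real_complex R (p y) * g y)) =
          p \* (fun y => complex.Im (g y)).
  by apply/funext => y; rewrite ImM /= mul0r addr0.
rewrite h1 h2; case: (g x) => a b /=.
by apply/eqP; rewrite eq_complex /= !mul0r subr0 addr0 !eqxx.
Qed.

End complex_conditional_expectation.

(** * Norm bounds for the operators M_W E M_U *)

Lemma le_half_poweR (R : realType) (x : \bar R) (c : R) :
  (0 <= x)%E -> 0 <= c -> ((x `^ 2^-1 <= c%:E) <-> (x <= (c ^+ 2)%:E))%E.
Proof.
move=> x0 c0.
have -> : (c%:E = (c ^+ 2)%:E `^ 2^-1)%E.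
  by rewrite poweR_EFin powR12_sqrt ?sqr_ge0// sqrtr_sqr ger0_norm.
split => le_xc; last first.
  apply: gt0_ler_poweR => //; rewrite in_itv/= leey andbT//.
  by rewrite lee_fin sqr_ge0.
have := @gt0_ler_poweR R 2 _ _ _ _ _ le_xc.
rewrite -!poweRrM mulVf// !poweRe1 ?lee_fin ?sqr_ge0//; apply => //.
- by rewrite in_itv/= leey andbT poweR_ge0.
- by rewrite in_itv/= lee_fin powR_ge0 leey.
Qed.

Section square_integral.
Local Open Scope ereal_scope.
Context d (X : measurableType d) (R : realType).
Variable mu : {measure set X -> \bar R}.
Implicit Types f g : X -> R[i].

(** Squared norms keep all estimates polynomial; see [L2normE]. *)
Definition sqint f : \bar R := \int[mu]_x ((normc (f x)) ^+ 2)%:E.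

Lemma sqint_ge0 f : 0 <= sqint f.
Proof. by apply: integral_ge0 => x _; rewrite lee_fin sqr_ge0. Qed.

Lemma L2normE f : L2norm mu f = (sqint f) `^ 2^-1.
Proof.
rewrite /L2norm unlock /sqint; congr (_ `^ _).
apply: eq_integral => x _ /=.
by rewrite ger0_norm ?normc_ge0// powR_mulrn ?normc_ge0.
Qed.

Lemma L2P f : L2 mu f <-> cmeasurable f /\ sqint f < +oo.
Proof.
split => -[mf ffin]; split => //; last by rewrite L2normE poweR_lty.
by move: ffin; rewrite L2normE; exact: lty_poweRy.
Qed.

Lemma measurable_sqnormc f : cmeasurable f ->
  measurable_fun setT (fun x => ((normc (f x)) ^+ 2)%:E).
Proof.
move=> mf; apply/measurable_EFinP; apply: measurable_funX.
exact: measurable_normc.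
Qed.

Lemma eq_ae_sqint f g : cmeasurable f -> cmeasurable g ->
  {ae mu, forall x, f x = g x} -> sqint f = sqint g.
Proof.
move=> mf mg fg; apply: ge0_ae_eq_integral => //.
- exact: measurable_sqnormc.
- exact: measurable_sqnormc.
- by move=> x _; rewrite lee_fin sqr_ge0.
- by move=> x _; rewrite lee_fin sqr_ge0.
- by apply: filterS fg => x -> _.
Qed.


End square_integral.

Section wce_bounds.
Local Open Scope ereal_scope.
Context d (X : measurableType d) (R : realType).
Variables (mu : {measure set X -> \bar R}) (A : set (set X)).
Hypotheses (A_sigma : sigma_algebra [set: X] A) (A_sub : A `<=` measurable).
Hypothesis A_sfinite : @sigma_finite _ (g_sigma_algebraType A) R setT mu.

Local Notation XA := (g_sigma_algebraType A).
Local Notation E f := (cond_expe mu A (EFin \o f)).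

Variables W U : X -> R.
Hypotheses (mW : measurable_fun setT W) (W0 : forall x, (0 <= W x)%R).
Hypotheses (mU : measurable_fun setT U) (U0 : forall x, (0 <= U x)%R).

(** The operator M_W E M_U for real weights; the weights of the operators of
    interest are nonnegative almost everywhere. *)
Definition rwce (f : X -> R[i]) : X -> R[i] := fun x =>
  (real_complex R (W x) * cond_exp mu A (fun y => real_complex R (U y) * f y) x)%R.

Let mWW : measurable_fun setT (W \* W)%R. Proof. exact: measurable_funM. Qed.
Let mUU : measurable_fun setT (U \* U)%R. Proof. exact: measurable_funM. Qed.
Let WW0 x : (0 <= (W \* W) x)%R. Proof. exact: mulr_ge0. Qed.
Let UU0 x : (0 <= (U \* U) x)%R. Proof. exact: mulr_ge0. Qed.

Lemma cmeasurable_rwce f : cmeasurable (rwce f).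
Proof.
apply: cmeasurableM; first exact: cmeasurable_real.
exact: (sub_cmeasurable A_sigma A_sub (cond_exp_measurable mu A _)).
Qed.

Lemma measurable_sub_sqnormc (f : X -> R[i]) :
  @cmeasurable _ XA R (f : XA -> R[i]) ->
  measurable_fun setT ((fun x => normc (f x) ^+ 2)%R : XA -> R).
Proof.
move=> mf; apply: measurable_funX; exact: (@measurable_normc _ XA).
Qed.

Lemma sqint_rwceE f :
  sqint mu (rwce f) = \int[mu]_x ((normc (cond_exp mu A
     (fun y => real_complex R (U y) * f y)%R x) ^+ 2)%:E * E (W \* W)%R x).
Proof.
rewrite (integral_pullout A_sigma A_sub A_sfinite)//; last 3 first.
- by apply: measurable_sub_sqnormc; exact: cond_exp_measurable.
- by move=> x; rewrite sqr_ge0.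
- exact: sub_setT.
rewrite /sqint; apply: eq_integral => x _; congr EFin.
by rewrite /rwce normcM normcR ger0_norm// exprMn mulrC.
Qed.

(** Pointwise, |E(U f)|^2 <= 4 E(U |f|)^2 <= 4 E(U^2) E(|f|^2), so that the left
    side, which is the integral of E(W^2) |E(U f)|^2, is at most 4 D times the
    integral of E(|f|^2). *)
Lemma sqint_rwce_le (D : R) f : (0 <= D)%R -> cmeasurable f ->
  {ae mu, forall x, E (W \* W)%R x * E (U \* U)%R x <= D%:E} ->
  sqint mu (rwce f) <= (4 * D)%:E * sqint mu f.
Proof.
move=> D0 mf leD.
pose q x := normc (f x).
have mq : measurable_fun setT q by exact: measurable_normc.
have q0 x : (0 <= q x)%R by exact: normc_ge0.
have mqq : measurable_fun setT (q \* q)%R by exact: measurable_funM.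
have qq0 x : (0 <= (q \* q) x)%R by exact: mulr_ge0.
have mUf : cmeasurable (fun y => real_complex R (U y) * f y)%R.
  by apply: cmeasurableM => //; exact: cmeasurable_real.
have := cond_exp_bound A_sigma A_sub A_sfinite mUf.
have -> : (@normc R \o (fun y => real_complex R (U y) * f y)%R) = (U \* q)%R.
  by apply/funext => y /=; rewrite normcM normcR ger0_norm.
move=> h1.
have h2 := cond_expe_cauchy_schwarz A_sigma A_sub A_sfinite mU U0 mq q0.
have sqintE : sqint mu f = \int[mu]_x E (q \* q)%R x.
  rewrite (integral_cond_expe A_sigma A_sub A_sfinite)//; exact: sub_setT.
rewrite sqint_rwceE sqintE -ge0_integralZl//; last 3 first.
- exact: cond_expe_measurable.
- by move=> x _; exact: cond_expe_ge0.
- by rewrite lee_fin mulr_ge0.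
apply: ae_ge0_le_integral => //.
- by move=> x _; rewrite mule_ge0 ?cond_expe_ge0// lee_fin sqr_ge0.
- apply: emeasurable_funM; last exact: cond_expe_measurable.
  apply/measurable_EFinP; apply: (sub_measurable_fun A_sigma A_sub).
  by apply: measurable_sub_sqnormc; exact: cond_exp_measurable.
- by move=> x _; rewrite mule_ge0 ?cond_expe_ge0// lee_fin mulr_ge0.
- apply: emeasurable_funM => //; exact: cond_expe_measurable.
apply: filterS3 h1 h2 leD => x h1 h2 leD _.
move: h1 h2 leD (cond_expe_ge0 mu A (EFin \o (U \* q)%R) x)
  (cond_expe_ge0 mu A (EFin \o (U \* U)%R) x)
  (cond_expe_ge0 mu A (EFin \o (W \* W)%R) x)
  (cond_expe_ge0 mu A (EFin \o (q \* q)%R) x).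
move: (E (U \* q)%R x) (E (U \* U)%R x) (E (W \* W)%R x) (E (q \* q)%R x).
move: (normc _) (normc_ge0 (cond_exp mu A
     (fun y => real_complex R (U y) * f y)%R x)) => n n0 c a e b h1 h2 leD c0 a0 e0 b0.
apply: (@le_trans _ _ ((2%:E * c) * (2%:E * c) * e)).
  apply: lee_wpmul2r => //; rewrite expr2 EFinM.
  by apply: lee_pmul => //; rewrite lee_fin.
have -> : (2%:E * c) * (2%:E * c) * e = 4%:E * (c * c * e).
  by rewrite muleACA -EFinM -natrM -[LHS]muleA.
rewrite EFinM -[leRHS]muleA; apply: lee_wpmul2l; first by rewrite lee_fin.
apply: (@le_trans _ _ (a * b * e)); first exact: lee_wpmul2r.
rewrite (muleC a) -muleA muleC; apply: lee_wpmul2r => //.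
by rewrite muleC.
Qed.

End wce_bounds.

Section wce_lower_bound.
Local Open Scope ereal_scope.
Context d (X : measurableType d) (R : realType).
Variables (mu : {measure set X -> \bar R}) (A : set (set X)).
Hypotheses (A_sigma : sigma_algebra [set: X] A) (A_sub : A `<=` measurable).
Hypothesis A_sfinite : @sigma_finite _ (g_sigma_algebraType A) R setT mu.

Local Notation XA := (g_sigma_algebraType A).
Local Notation E f := (cond_expe mu A (EFin \o f)).

Variables W U : X -> R.
Hypotheses (mW : measurable_fun setT W) (W0 : forall x, (0 <= W x)%R).
Hypotheses (mU : measurable_fun setT U) (U0 : forall x, (0 <= U x)%R).

Lemma cond_expe_cst (c : R) : (0 <= c)%R ->
  {ae mu, forall x, cond_expe mu A (EFin \o cst c) x = c%:E}.
Proof. by move=> c0; apply: (cond_expe_unique A_sigma A_sub A_sfinite). Qed.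

Lemma sub_measurable_indic (B : set X) : A B ->
  measurable_fun setT (\1_B : XA -> R).
Proof.
by move=> AB; apply: measurable_indic; exact/(measurable_subE A_sigma).
Qed.

Let mWW : measurable_fun setT (W \* W)%R. Proof. exact: measurable_funM. Qed.
Let mUU : measurable_fun setT (U \* U)%R. Proof. exact: measurable_funM. Qed.
Let WW0 x : (0 <= (W \* W) x)%R. Proof. exact: mulr_ge0. Qed.
Let UU0 x : (0 <= (U \* U) x)%R. Proof. exact: mulr_ge0. Qed.

(** The test functions are restrictions of the truncations of U, and p is the
    square of the truncation. *)
Let ut (k : nat) : X -> R := (U \* \1_[set x | (U x <= k%:R)%R])%R.
Let p k : X -> R := (U \* ut k)%R.

Let mut k : measurable_fun setT (ut k).
Proof.
apply: measurable_funM => //; apply: measurable_indic.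
rewrite -[X in measurable X]setTI.
have := @emeasurable_fun_infty_c _ X R setT (EFin \o U) measurableT.
by move=> /(_ _ k%:R%:E); apply; exact/measurable_EFinP.
Qed.

Let ut0 k x : (0 <= ut k x)%R. Proof. exact: mulr_ge0. Qed.
Let mp k : measurable_fun setT (p k). Proof. exact: measurable_funM. Qed.
Let p0 k x : (0 <= p k x)%R. Proof. exact: mulr_ge0. Qed.

Let pE k x : p k x = (ut k x ^+ 2)%R.
Proof.
rewrite /p /ut expr2 /= indicE; case: (_ \in _) => /=; last by rewrite !mulr0.
by rewrite !mulr1.
Qed.

Let p_le k x : (p k x <= k%:R ^+ 2)%R.
Proof.
rewrite pE lerXn2r ?nnegrE// /ut /= indicE.
case: (boolP (x \in _)) => [/set_mem/= h|_] /=; first by rewrite mulr1.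
by rewrite mulr0.
Qed.

(** Test on f = ut 1_(B & F) for B in A.  As U f = p 1_(B & F), the hypothesis
    reads: the integral of E(W^2) E(p)^2 over B & F is at most D times that of
    E(p).  By comparison E(W^2) E(p)^2 <= D E(p) on F, and E(p) is finite. *)
Lemma truncated_gauge_le (D : R) (F : set X) k : (0 <= D)%R -> A F -> mu F < +oo ->
  (forall f, L2 mu f -> sqint mu (rwce mu A W U f) <= D%:E * sqint mu f) ->
  {ae mu, forall x, F x -> E (W \* W)%R x * E (p k) x <= D%:E}.
Proof.
move=> D0 AF Ffin leD.
pose e x := fine (E (p k) x).
have me : measurable_fun setT (e : XA -> R).
  by apply: (measurableT_comp (fine_measurable measurableT));
    exact: cond_expe_sub_measurable.
have e0 x : (0 <= e x)%R by rewrite fine_ge0// cond_expe_ge0.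
have k0 : (0 <= k%:R ^+ 2 :> R)%R by rewrite sqr_ge0.
have p_fin : {ae mu, forall x, E (p k) x = (e x)%:E}.
  have h1 := le_cond_expe A_sigma A_sub A_sfinite (mp k) (p0 k)
     (@measurable_cst _ _ X R setT (k%:R ^+ 2)%R) (fun=> k0)
     (aeW _ (p_le k)).
  apply: filterS2 h1 (cond_expe_cst k0) => x h1 h2.
  rewrite /e fineK// ge0_fin_numE ?cond_expe_ge0//.
  by apply: (le_lt_trans h1); rewrite [ltLHS]h2 ltry.
pose iF : X -> R := \1_F.
have miF : measurable_fun setT (iF : XA -> R) by exact: sub_measurable_indic.
pose g x := ((e x * iF x) ^+ 2)%:E * E (W \* W)%R x.
pose g' x := D%:E * ((iF x)%:E * E (p k) x).
have mg : measurable_fun setT (g : XA -> \bar R).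
  apply: emeasurable_funM; last exact: cond_expe_sub_measurable.
  by apply/measurable_EFinP; apply: measurable_funX; exact: measurable_funM.
have mg' : measurable_fun setT (g' : XA -> \bar R).
  apply: emeasurable_funM => //.
  apply: emeasurable_funM; last exact: cond_expe_sub_measurable.
  exact/measurable_EFinP.
have g0 x : 0 <= g x by rewrite mule_ge0 ?cond_expe_ge0// lee_fin sqr_ge0.
have g'0 x : 0 <= g' x by rewrite !mule_ge0 ?cond_expe_ge0// lee_fin.
have : {ae mu, forall x, g x <= g' x}.
  apply: (le_integral_ae_le A_sigma A_sub A_sfinite) => // B AB.
  pose i : X -> R := \1_(B `&` F).
  have iE x : i x = (iF x * \1_B x)%R by rewrite /i /iF indicI mulrC.
  have ABF : A (B `&` F).
    by apply/(measurable_subE A_sigma); apply: measurableI;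
      exact/(measurable_subE A_sigma).
  have mi : measurable_fun setT (i : XA -> R) by exact: sub_measurable_indic.
  have miX := sub_measurable_fun A_sigma A_sub mi.
  have i0 x : (0 <= i x)%R by [].
  have ii x : (i x * i x = i x)%R.
    by rewrite /i indicE; case: (_ \in _); rewrite ?mulr1 ?mulr0.
  pose f x := real_complex R (ut k x * i x)%R.
  have mf : cmeasurable f by apply: cmeasurable_real; exact: measurable_funM.
  have sqf : sqint mu f = \int[mu]_x ((i x)%:E * E (p k) x).
    rewrite (integral_pullout A_sigma A_sub A_sfinite)//; last exact: sub_setT.
    rewrite /sqint; apply: eq_integral => x _; congr EFin.
    rewrite /f normcR ger0_norm ?mulr_ge0// exprMn -pE mulrC.
    by rewrite expr2 ii.
  have L2f : L2 mu f.
    apply/L2P; split => //; rewrite sqf.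
    rewrite (integral_pullout A_sigma A_sub A_sfinite)//; last exact: sub_setT.
    apply: (@le_lt_trans _ _ (\int[mu]_x ((k%:R ^+ 2)%:E * (i x)%:E))).
      apply: ge0_le_integral => //.
      - by move=> x _; rewrite lee_fin mulr_ge0.
      - by apply/measurable_EFinP; exact: measurable_funM.
      - by apply: emeasurable_funM => //; exact/measurable_EFinP.
      - by move=> x _; rewrite -EFinM lee_fin mulrC ler_wpM2r.
    have mBF : measurable (B `&` F) by exact: A_sub.
    have miE : measurable_fun setT (EFin \o i) by exact/measurable_EFinP.
    rewrite ge0_integralZl//; last by move=> x _; rewrite lee_fin.
    rewrite integral_indic// setIT lte_mul_pinfty ?lee_fin//.
    apply: le_lt_trans Ffin; apply: le_measure; rewrite ?inE//.
    exact: A_sub.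
  have := leD _ L2f; rewrite sqf.
  have -> : sqint mu (rwce mu A W U f) = \int[mu]_(x in B) g x.
    rewrite (sqint_rwceE A_sigma A_sub A_sfinite U mW W0) [RHS]integral_mkcond.
    have -> : (fun y => real_complex R (U y) * f y)%R =
              (fun y => real_complex R (p k y) * real_complex R (i y))%R.
      by apply/funext => y; rewrite /f /p -!rmorphM/= mulrA.
    apply: ge0_ae_eq_integral => //.
    - apply: emeasurable_funM; last exact: cond_expe_measurable.
      apply/measurable_EFinP; apply: (sub_measurable_fun A_sigma A_sub).
      by apply: measurable_sub_sqnormc; exact: cond_exp_measurable.
    - apply/(measurable_restrictT _ _).1; first exact: A_sub.
      by apply: measurable_funTS; exact: (sub_measurable_fun A_sigma A_sub mg).
    - by move=> x _; rewrite mule_ge0 ?cond_expe_ge0// lee_fin sqr_ge0.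
    - by move=> x _; rewrite erestrict_ge0.
    - have ci : @cmeasurable _ XA R ((fun y => real_complex R (i y)) : XA -> R[i]).
        exact: cmeasurable_real.
      have := cond_exp_pullout A_sigma A_sub A_sfinite (mp k) (p0 k) ci.
      apply: filterS => x -> _.
      rewrite epatch_indic /g normcM !normcR (ger0_norm (e0 x)) (ger0_norm (i0 x)).
      rewrite iE !exprMn -!muleA (muleC (E _ _)) !muleA -EFinM; congr (_%:E * _).
      by rewrite -[RHS]mulrA; congr (_ * (_ * _))%R; rewrite indicE; case: (_ \in _);
        rewrite ?expr1n ?expr0n.
  suff -> : D%:E * (\int[mu]_x ((i x)%:E * E (p k) x)) = \int[mu]_(x in B) g' x by [].
  rewrite -ge0_integralZl//; last 2 first.
  - apply: emeasurable_funM; last exact: cond_expe_measurable.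
    exact/measurable_EFinP.
  - by move=> x _; rewrite mule_ge0 ?cond_expe_ge0// lee_fin.
  rewrite [RHS]integral_mkcond; apply: eq_integral => x _.
  rewrite epatch_indic /g' iE EFinM -!muleA; congr (_ * (_ * _)).
  by rewrite muleC.
apply: filterS2 p_fin => x pe + Fx.
rewrite /g /g' pe /iF indicE mem_set// mulr1 mul1e.
move: (e x) (e0 x) (E (W \* W)%R x) (cond_expe_ge0 mu A (EFin \o (W \* W)%R) x).
move=> c c0 y y0; have [->|cn0] := eqVneq c 0%R; first by move=> _; rewrite mule0 lee_fin.
have cgt0 : (0 < c)%R by rewrite lt0r cn0.
rewrite expr2 EFinM -muleA (muleC D%:E) lee_pmul2l ?lte_fin//.
by rewrite muleC.
Qed.

(** Let k go to infinity in [truncated_gauge_le], inside the integrals over the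
    sets of A, where monotone convergence applies.  For that E(W^2) is moved
    inside E, which requires a real multiplier: it is first replaced by its
    truncations y m. *)
Lemma rwce_bound_gauge_le (D : R) : (0 <= D)%R ->
  (forall f, L2 mu f -> sqint mu (rwce mu A W U f) <= D%:E * sqint mu f) ->
  {ae mu, forall x, E (W \* W)%R x * E (U \* U)%R x <= D%:E}.
Proof.
move=> D0 leD.
have [F [FT ndF AF Ffin]] := sub_sigma_finite_exhaustion A_sigma A_sub A_sfinite.
pose Y := E (W \* W)%R.
pose y m x := fine (mine (Y x) m%:R%:E).
have m0 m : 0 <= (m%:R%:E : \bar R) by rewrite lee_fin.
have Y0 x : 0 <= Y x by exact: cond_expe_ge0.
have mY : measurable_fun setT (Y : XA -> \bar R).
  exact: cond_expe_sub_measurable.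
have y0 m x : (0 <= y m x)%R.
  by rewrite fine_ge0 ?le_min ?Y0 ?m0.
have yE m x : (y m x)%:E = mine (Y x) m%:R%:E.
  rewrite fineK// ge0_fin_numE ?le_min ?Y0 ?m0//.
  by rewrite gt_min ltry orbT.
have my m : measurable_fun setT (y m : XA -> R).
  apply: (measurableT_comp (fine_measurable measurableT)).
  exact: measurable_mine.
have ybound m : {ae mu, forall x, (y m x)%:E * E (U \* U)%R x <= D%:E}.
  have myX := sub_measurable_fun A_sigma A_sub (my m).
  apply: (le_integral_ae_le A_sigma A_sub A_sfinite).
  - apply: emeasurable_funM; last exact: cond_expe_sub_measurable.
    exact/measurable_EFinP.
  - exact: measurable_cst.
  - by move=> x; rewrite mule_ge0 ?cond_expe_ge0// lee_fin.
  - by move=> x; rewrite lee_fin.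
  move=> B AB; have mB : measurable B by exact: A_sub.
  rewrite (integral_pullout A_sigma A_sub A_sfinite)//.
  (* h k increases to y m * U^2, everywhere. *)
  pose h k x := (y m x * \1_(F k) x * p k x)%R.
  have mF k : measurable (F k) by exact: A_sub.
  have mh k : measurable_fun setT (h k).
    by apply: measurable_funM => //; apply: measurable_funM => //; exact: measurable_indic.
  have h0 k x : (0 <= h k x)%R by rewrite !mulr_ge0.
  have ndF' k l x : (k <= l)%N -> F k x -> F l x.
    by move=> kl; have /subsetPset := ndF _ _ kl; apply.
  have ndh x k l : (k <= l)%N -> (h k x <= h l x)%R.
    move=> kl; rewrite /h -!mulrA ler_wpM2l//; apply: ler_pM => //.
      rewrite !indicE; case: (boolP (x \in F k)) => // /set_mem/(ndF' _ _ _ kl) Fx.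
      by rewrite mem_set.
    rewrite /p /ut /= !mulrA ler_wpM2l//.
      exact: mulr_ge0.
    rewrite !indicE; case: (boolP (x \in [set x | (U x <= k%:R)%R])) => // /set_mem/= Ux.
    by rewrite mem_set//= (le_trans Ux)// ler_nat.
  have cvgh x : (h k x)%:E @[k --> \oo] --> (y m x * (U \* U)%R x)%:E.
    have : (\bigcup_i F i) x by rewrite FT.
    move=> [n _ Fnx]; pose N := maxn n (Num.bound (U x)).
    apply: (cvg_trans (near_eq_cvg _) (cvg_cst _)).
    exists N => // k /= Nk; congr EFin.
    rewrite /h /p /ut /= !indicE !mem_set//=; last 2 first.
      rewrite (le_trans (ltW (archi_boundP (U0 x))))// ler_nat.
      by rewrite (leq_trans _ Nk)// leq_maxr.
      by apply: ndF' Fnx; rewrite (leq_trans _ Nk)// leq_maxl.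
    by rewrite !mulr1.
  have cvgI : \int[mu]_(x in B) (h k x)%:E @[k --> \oo] -->
      \int[mu]_(x in B) (y m x * (U \* U)%R x)%:E.
    rewrite (eq_integral (fun x => limn (fun k => (h k x)%:E))); last first.
      by move=> x _; apply/esym/cvg_lim => //; exact: cvgh.
    apply: cvg_monotone_convergence => //.
    - by move=> k; apply: measurable_funTS; exact/measurable_EFinP.
    - by move=> k x _; rewrite lee_fin.
    - by move=> x _ k l kl; rewrite lee_fin ndh.
  rewrite -(cvg_lim _ cvgI)//; apply: lime_le; first by apply/cvg_ex; eexists; exact: cvgI.
  apply: nearW => k.
  have my1 : measurable_fun setT ((fun x => y m x * \1_(F k) x)%R : XA -> R).
    by apply: measurable_funM => //; exact: sub_measurable_indic.
  rewrite -(integral_pullout A_sigma A_sub A_sfinite my1 _ (mp k) (p0 k))//; last first.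
    by move=> x; rewrite mulr_ge0.
  apply: ae_ge0_le_integral => //.
  - by move=> x _; rewrite mule_ge0 ?cond_expe_ge0// lee_fin mulr_ge0.
  - apply: measurable_funTS; apply: emeasurable_funM; last exact: cond_expe_measurable.
    by apply/measurable_EFinP; exact: (sub_measurable_fun A_sigma A_sub my1).
  have tb := truncated_gauge_le k D0 (AF k) (Ffin k) leD.
  apply: filterS tb => x h1 _.
  rewrite indicE; case: (boolP (x \in F k)) => [/set_mem Fx|_]; last first.
    by rewrite mulr0 mul0e lee_fin.
  rewrite mulr1 yE; apply: le_trans (h1 Fx); apply: lee_wpmul2r.
    exact: cond_expe_ge0.
  by rewrite ge_min lexx.
have := ae_foralln ybound; apply: filterS => x h; rewrite -/(Y x).
have [Yfin|] := boolP (Y x \is a fin_num).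
  have := h (Num.bound (fine (Y x))); rewrite yE.
  rewrite (_ : mine _ _ = Y x)//; apply/min_idPl.
  by rewrite -[leLHS]fineK// lee_fin ltW// archi_boundP// fine_ge0.
rewrite ge0_fin_numE// -leNgt leye_eq => /eqP Yy; rewrite Yy.
have {}h m : m%:R%:E * E (U \* U)%R x <= D%:E.
  by have := h m; rewrite yE Yy minye.
move: (E (U \* U)%R x) (cond_expe_ge0 mu A (EFin \o (U \* U)%R) x) h => [u| |]//.
  rewrite lee_fin le_eqVlt => /predU1P[<-|u_gt0] h; first by rewrite mule0 lee_fin.
  have := h (Num.bound (D / u)); rewrite -EFinM lee_fin leNgt.
  by rewrite -ltr_pdivrMr// archi_boundP// divr_ge0// ltW.
move=> _ /(_ 1%N); rewrite mul1e leye_eq.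
by [].
Qed.

End wce_lower_bound.

(** * Cesaro means of M_W E M_U *)

Section operator_norm.
Local Open Scope ereal_scope.
Context d (X : measurableType d) (R : realType).
Variable mu : {measure set X -> \bar R}.
Implicit Types (f g : X -> R[i]) (T : (X -> R[i]) -> (X -> R[i])).

Lemma sqintZ (c : R) f : cmeasurable f ->
  sqint mu (fun x => real_complex R c * f x)%R = (c ^+ 2)%:E * sqint mu f.
Proof.
move=> mf; rewrite /sqint -ge0_integralZl//.
- apply: eq_integral => x _; rewrite -EFinM normcM normcR exprMn.
  by rewrite -normrX ger0_norm ?sqr_ge0.
- exact: measurable_sqnormc.
- by move=> x _; rewrite lee_fin sqr_ge0.
- by rewrite lee_fin sqr_ge0.
Qed.

Lemma sqintD_le f g : cmeasurable f -> cmeasurable g ->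
  sqint mu (fun x => f x + g x)%R <= 2%:E * (sqint mu f + sqint mu g).
Proof.
move=> mf mg; rewrite /sqint -ge0_integralD//; first last.
- exact: measurable_sqnormc.
- by move=> x _; rewrite lee_fin sqr_ge0.
- exact: measurable_sqnormc.
- by move=> x _; rewrite lee_fin sqr_ge0.
rewrite -ge0_integralZl//; first last.
- by move=> x _; rewrite -EFinD lee_fin addr_ge0 ?sqr_ge0.
- by apply: emeasurable_funD; exact: measurable_sqnormc.
apply: ge0_le_integral => //.
- by move=> x _; rewrite lee_fin sqr_ge0.
- by apply: measurable_sqnormc; exact: cmeasurableD.
- apply: emeasurable_funM => //.
  by apply: emeasurable_funD; exact: measurable_sqnormc.
move=> x _; rewrite -EFinD -EFinM lee_fin.
have := le_normcD (f x) (g x).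
move: (normc_ge0 (f x + g x)%R) (normc_ge0 (f x)) (normc_ge0 (g x)).
move: (normc _) (normc (f x)) (normc (g x)) => a b c a0 b0 c0 abc.
apply: (@le_trans _ _ ((b + c) ^+ 2)%R); first by rewrite lerXn2r ?nnegrE ?addr_ge0.
have := sqr_ge0 (b - c)%R; rewrite !expr2; nra.
Qed.

Lemma opnorm_le T (M : R) : (0 <= M)%R ->
  (forall f, L2 mu f -> sqint mu (T f) <= (M ^+ 2)%:E * sqint mu f) ->
  opnorm mu T <= M%:E.
Proof.
move=> M0 h; apply: ge_ereal_sup => _ [f [L2f f1] <-].
apply: (@le_trans _ _ (M%:E * L2norm mu f)); first last.
  by rewrite -[leRHS]mule1; apply: lee_wpmul2l.
rewrite !L2normE -[M in M%:E]ger0_norm// -sqrtr_sqr -powR12_sqrt ?sqr_ge0//.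
rewrite -poweR_EFin -poweRM ?sqint_ge0 ?lee_fin ?sqr_ge0//.
apply: gt0_ler_poweR; rewrite ?in_itv/= ?leey ?andbT ?sqint_ge0 ?h//.
by rewrite mule_ge0 ?sqint_ge0// lee_fin sqr_ge0.
Qed.

Lemma L2Z (c : R) f : L2 mu f -> L2 mu (fun x => real_complex R c * f x)%R.
Proof.
move=> /L2P[mf ffin]; apply/L2P; split.
  by apply: cmeasurableM => //; exact/cmeasurable_real/measurable_cst.
by rewrite sqintZ// lte_mul_pinfty ?lee_fin ?sqr_ge0// sqint_ge0.
Qed.

(** Scale f to norm 1.  When f has norm 0, all its multiples have norm at most
    1, which forces T f to have norm 0. *)
Lemma sqint_le_opnorm T (M : R) : (0 <= M)%R ->
  (forall f, cmeasurable f -> cmeasurable (T f)) ->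
  (forall c f, (0 <= c)%R -> cmeasurable f ->
    {ae mu, forall x, T (fun y => real_complex R c * f y)%R x =
                      (real_complex R c * T f x)%R}) ->
  opnorm mu T <= M%:E ->
  forall f, L2 mu f -> sqint mu (T f) <= (M ^+ 2)%:E * sqint mu f.
Proof.
move=> M0 mT TZ TM f L2f; have [mf ffin] := (L2P mu f).1 L2f.
have key (c : R) : (0 <= c)%R -> (c ^+ 2)%:E * sqint mu f <= 1 ->
    (c ^+ 2)%:E * sqint mu (T f) <= (M ^+ 2)%:E.
  move=> c0 cf1.
  have mcf : cmeasurable (fun x => real_complex R c * f x)%R.
    by apply: cmeasurableM => //; exact/cmeasurable_real/measurable_cst.
  have mcTf : cmeasurable (fun x => real_complex R c * T f x)%R.
    by apply: cmeasurableM; [exact/cmeasurable_real/measurable_cst|exact: mT].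
  rewrite -sqintZ; last exact: mT.
  rewrite -(eq_ae_sqint (mT _ mcf) mcTf (TZ c f c0 mf)).
  have Tcf : L2norm mu (T (fun x => real_complex R c * f x)%R) <= M%:E.
    apply: le_trans TM; apply: ereal_sup_ubound.
    exists (fun x => real_complex R c * f x)%R => //; split; first exact: L2Z.
    rewrite L2normE sqintZ// -(poweR1r 2^-1); apply: gt0_ler_poweR => //.
    - by rewrite in_itv/= leey andbT mule_ge0 ?sqint_ge0// lee_fin sqr_ge0.
    - by rewrite in_itv/= leey andbT.
  rewrite L2normE in Tcf.
  exact: (le_half_poweR (sqint_ge0 _ _) M0).1.
have := sqint_ge0 mu f; rewrite le_eqVlt => /predU1P[f0|f_gt0].
  rewrite -f0 in key *; rewrite mule0.
  have {}key (k : nat) : (k%:R ^+ 2)%:E * sqint mu (T f) <= (M ^+ 2)%:E.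
    by apply: key => //; rewrite mule0.
  move: (sqint mu (T f)) (sqint_ge0 mu (T f)) key => [t| |]// t0 key.
    rewrite lee_fin leNgt; apply/negP => t_gt0.
    have := key (Num.bound (M ^+ 2 / t)).+1; rewrite -EFinM lee_fin leNgt => /negP; apply.
    rewrite -ltr_pdivrMr//.
    apply: (@lt_le_trans _ _ (Num.bound (M ^+ 2 / t))%:R).
      by rewrite archi_boundP// divr_ge0// ?sqr_ge0// ltW.
    rewrite -natrX ler_nat.
    by rewrite (leq_trans (leqnSn _))// -[leqLHS]expn1 leq_pexp2l.
  by have := key 1%N; rewrite expr1n mul1e leye_eq.
move: f_gt0 ffin key; case: (sqint mu f) => [s| |]//.
rewrite lte_fin => s0 _ key.
have := key (Num.sqrt s)^-1%R; rewrite invr_ge0 sqrtr_ge0 => /(_ isT).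
rewrite exprVn sqr_sqrtr ?(ltW s0)// -EFinM mulVf ?gt_eqF// lexx => /(_ isT).
by rewrite muleC lee_pdivrMr.
Qed.

End operator_norm.

Section wce_iterates.
Context d (X : measurableType d) (R : realType).
Variables (mu : {measure set X -> \bar R}) (A : set (set X)).
Hypotheses (A_sigma : sigma_algebra [set: X] A) (A_sub : A `<=` measurable).
Hypothesis A_sfinite : @sigma_finite _ (g_sigma_algebraType A) R setT mu.

Local Notation XA := (g_sigma_algebraType A).
Local Notation E f := (cond_expe mu A (EFin \o f)).

Lemma cond_exprZ (c : R) (q : X -> R) : 0 <= c -> measurable_fun setT q ->
  {ae mu, forall x, cond_expr mu A (fun y => c * q y) x = c * cond_expr mu A q x}.
Proof.
move=> c0 mq.
have mc : measurable_fun setT (cst c : XA -> R) by exact: measurable_cst.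
have h1 := cond_expe_pullout A_sigma A_sub A_sfinite mc (fun=> c0)
  (measurable_funrpos mq) (funrpos_ge0 q).
have h2 := cond_expe_pullout A_sigma A_sub A_sfinite mc (fun=> c0)
  (measurable_funrneg mq) (funrneg_ge0 q).
apply: filterS2 h1 h2 => x h1 h2; rewrite /cond_expr.
rewrite ge0_funrposM// ge0_funrnegM// [X in fine X - _]h1 [X in _ - fine X]h2.
rewrite mulrBr; congr (_ - _).
  case: (E q^\+ x) (cond_expe_ge0 mu A (EFin \o q^\+) x) => [t| |]//= _.
  rewrite mulr0; move: c0; rewrite le_eqVlt => /predU1P[<-|c0]; first by rewrite mul0e.
  by rewrite gt0_muley.
case: (E q^\- x) (cond_expe_ge0 mu A (EFin \o q^\-) x) => [t| |]//= _.
rewrite mulr0; move: c0; rewrite le_eqVlt => /predU1P[<-|c0]; first by rewrite mul0e.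
by rewrite gt0_muley.
Qed.

Lemma cond_expZ (c : R) (f : X -> R[i]) : 0 <= c -> cmeasurable f ->
  {ae mu, forall x, cond_exp mu A (fun y => real_complex R c * f y) x =
                    real_complex R c * cond_exp mu A f x}.
Proof.
move=> c0 [fr fi]; apply: filterS2 (cond_exprZ c0 fr) (cond_exprZ c0 fi) => x h1 h2.
rewrite /cond_exp.
have -> : (fun y => complex.Re (real_complex R c * f y)) =
          (fun y => c * complex.Re (f y)).
  by apply/funext => y; rewrite ReM /= mul0r subr0.
have -> : (fun y => complex.Im (real_complex R c * f y)) =
          (fun y => c * complex.Im (f y)).
  by apply/funext => y; rewrite ImM /= mul0r addr0.
by rewrite h1 h2; apply/eqP; rewrite eq_complex /= !mul0r subr0 addr0 !eqxx.
Qed.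

Variables W U : X -> R.
Hypotheses (mW : measurable_fun setT W) (W0 : forall x, (0 <= W x)%R).
Hypotheses (mU : measurable_fun setT U) (U0 : forall x, (0 <= U x)%R).
Variable T : (X -> R[i]) -> (X -> R[i]).
Hypothesis mT : forall f, cmeasurable f -> cmeasurable (T f).
Hypothesis TE : forall f, cmeasurable f ->
  {ae mu, forall x, T f x = rwce mu A W U f x}.

(** The function h by which T multiplies its own range. *)
Definition wce_symbol (x : X) : R := fine (E (U \* W) x).
Local Notation h := wce_symbol.

(** The real counterpart of [vsum]. *)
Definition geom (n : nat) (x : X) : R := \sum_(i < n.-1) h x ^+ i.

Lemma wce_symbol_ge0 x : 0 <= h x.
Proof. by rewrite fine_ge0// cond_expe_ge0. Qed.

Lemma measurable_wce_symbol : measurable_fun setT (h : XA -> R).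
Proof.
by apply: (measurableT_comp (fine_measurable measurableT));
  exact: cond_expe_sub_measurable.
Qed.

Lemma geom_ge0 n x : 0 <= geom n x.
Proof. by apply: sumr_ge0 => i _; rewrite exprn_ge0// wce_symbol_ge0. Qed.

Lemma measurable_geom n : measurable_fun setT (geom n : XA -> R).
Proof.
apply: measurable_sum => i; apply: measurable_funX.
exact: measurable_wce_symbol.
Qed.

Let mUc f : cmeasurable f -> cmeasurable (fun y => real_complex R (U y) * f y).
Proof. by move=> mf; apply: cmeasurableM => //; exact: cmeasurable_real. Qed.

Let cmX (f : X -> R[i]) : @cmeasurable _ XA R (f : XA -> R[i]) -> cmeasurable f.
Proof. exact: (sub_cmeasurable A_sigma A_sub). Qed.

Let hpow i : @cmeasurable _ XA R ((fun x => real_complex R (h x ^+ i)) : XA -> R[i]).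
Proof.
apply: cmeasurable_real; apply: measurable_funX; exact: measurable_wce_symbol.
Qed.

Lemma cmeasurable_iter f i : cmeasurable f -> cmeasurable (iter i T f).
Proof. by move=> mf; elim: i => //= i IH; exact: mT. Qed.

(** T^(i+2) f = W E(U W h^i E(U f)), in which E(U f) and the powers of h are
    measurable for A and come out of E, leaving E(UW) = h. *)
Lemma wce_iterE f i : cmeasurable f ->
  {ae mu, forall x, iter i.+1 T f x = real_complex R (h x ^+ i) * rwce mu A W U f x}.
Proof.
move=> mf; elim: i => [|i IH].
  by apply: filterS (TE mf) => x; rewrite expr0 rmorph1 mul1r.
have mI := cmeasurable_iter i.+1 mf.
pose g x := real_complex R (h x ^+ i) * cond_exp mu A
              (fun y => real_complex R (U y) * f y) x.
have mg : @cmeasurable _ XA R (g : XA -> R[i]).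
  apply: (@cmeasurableM _ XA) => //; exact: cond_exp_measurable.
have e : cond_exp mu A (fun y => real_complex R (U y) * iter i.+1 T f y) =
         cond_exp mu A (fun y => real_complex R ((U \* W) y) * g y).
  apply: (eq_ae_cond_exp A_sub).
  - exact: mUc.
  - apply: cmeasurableM; last exact: cmX.
    by apply: cmeasurable_real; exact: measurable_funM.
  - apply: filterS IH => x ->; rewrite /g /rwce rmorphM/=; ring.
have mUW : measurable_fun setT (U \* W) by exact: measurable_funM.
have UW0 x : 0 <= (U \* W) x by exact: mulr_ge0.
apply: filterS2 (TE mI) (cond_exp_pullout A_sigma A_sub A_sfinite mUW UW0 mg).
move=> x h1 h2; rewrite [LHS]h1 {1}/rwce e h2 /g /rwce exprS -/(h x) rmorphM/=.
ring.
Qed.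

Lemma rwce_geomE n f x : rwce mu A (geom n \* W) U f x =
  real_complex R (geom n x) * rwce mu A W U f x.
Proof. by rewrite /rwce rmorphM/= mulrA. Qed.

Lemma cesaro_meanE n f : (0 < n)%N -> cmeasurable f ->
  {ae mu, forall x, cesaro_mean T n f x =
     real_complex R n%:R^-1 * (f x + rwce mu A (geom n \* W) U f x)}.
Proof.
case: n => // n _ mf.
have := ae_foralln (fun i => wce_iterE i mf); apply: filterS => x hx.
rewrite /cesaro_mean rmorphV/= ?rmorph_nat; last by rewrite unitfE pnatr_eq0.
congr (_ * _); rewrite big_ord_recl; congr (_ + _).
rewrite rwce_geomE /geom rmorph_sum/= mulr_suml; apply: eq_bigr => i _.
exact: hx.
Qed.

Lemma cmeasurable_cesaro n f : cmeasurable f -> cmeasurable (cesaro_mean T n f).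
Proof.
move=> mf; apply: cmeasurableM.
  rewrite (_ : (fun=> _) = (fun=> real_complex R n%:R^-1)).
    exact/cmeasurable_real/measurable_cst.
  by apply/funext => x; rewrite fmorphV/= rmorph_nat.
by apply: cmeasurable_sum => i; exact: cmeasurable_iter.
Qed.

Lemma rwceZ (V : X -> R) (c : R) f : 0 <= c -> cmeasurable f ->
  {ae mu, forall x, rwce mu A V U (fun y => real_complex R c * f y) x =
                    real_complex R c * rwce mu A V U f x}.
Proof.
move=> c0 mf; apply: filterS (cond_expZ c0 (mUc mf)) => x hx.
rewrite /rwce.
have -> : (fun y => real_complex R (U y) * (real_complex R c * f y)) =
          (fun y => real_complex R c * (real_complex R (U y) * f y)).
  by apply/funext => y; rewrite mulrCA.
by rewrite hx mulrCA.
Qed.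

Lemma cesaro_meanZ n (c : R) f : (0 < n)%N -> 0 <= c -> cmeasurable f ->
  {ae mu, forall x, cesaro_mean T n (fun y => real_complex R c * f y) x =
                    real_complex R c * cesaro_mean T n f x}.
Proof.
move=> n0 c0 mf.
have mcf : cmeasurable (fun x => real_complex R c * f x).
  by apply: cmeasurableM => //; exact/cmeasurable_real/measurable_cst.
apply: filterS3 (cesaro_meanE n0 mcf) (cesaro_meanE n0 mf)
  (rwceZ (geom n \* W) c0 mf) => x -> -> ->.
by rewrite -mulrDr mulrCA.
Qed.

Lemma cond_expe_geom n : {ae mu, forall x,
  (E ((geom n \* W) \* (geom n \* W))%R x = (geom n x ^+ 2)%:E * E (W \* W)%R x)%E}.
Proof.
have mWW : measurable_fun setT (W \* W) by exact: measurable_funM.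
have mg2 : measurable_fun setT ((fun x => geom n x ^+ 2) : XA -> R).
  by apply: measurable_funX; exact: measurable_geom.
have WW0 x : 0 <= (W \* W) x by exact: mulr_ge0.
have := cond_expe_pullout A_sigma A_sub A_sfinite mg2 (fun=> sqr_ge0 _) mWW WW0.
apply: filterS => x <-; congr (cond_expe _ _ _ x); apply/funext => y /=.
by congr EFin; ring.
Qed.

(** Its essential supremum is equivalent to the square of the norm of M_W E M_U,
    by [sqint_rwce_le] and [rwce_bound_gauge_le]. *)
Definition wce_gauge x : \bar R := (E (W \* W)%R x * E (U \* U)%R x)%E.

Local Open Scope ereal_scope.

Let mgW n : measurable_fun setT (geom n \* W)%R.
Proof.
apply: measurable_funM => //.
exact: (sub_measurable_fun A_sigma A_sub (measurable_geom n)).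
Qed.

Let gW0 n x : (0 <= (geom n \* W) x)%R.
Proof. by rewrite mulr_ge0// geom_ge0. Qed.

Let mrwce (V : X -> R) f : measurable_fun setT V -> cmeasurable (rwce mu A V U f).
Proof. by move=> mV; exact: cmeasurable_rwce. Qed.

Lemma opnorm_lty_bound (S : (X -> R[i]) -> (X -> R[i])) : opnorm mu S < +oo ->
  exists2 M : R, (0 <= M)%R & opnorm mu S <= M%:E.
Proof.
case: (opnorm mu S) => [m| |]// _; last by exists 0%R => //; rewrite leNye.
by exists (Num.max m 0)%R; rewrite ?lee_fin le_max lexx ?orbT.
Qed.

Lemma bounded_op_gauge : bounded_op mu T ->
  exists2 D : R, (0 <= D)%R & {ae mu, forall x, wce_gauge x <= D%:E}.
Proof.
move=> [_ /opnorm_lty_bound[M M0 TM]]; exists (M ^+ 2)%R; first exact: sqr_ge0.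
apply: (rwce_bound_gauge_le A_sigma A_sub A_sfinite) => //; first exact: sqr_ge0.
move=> f L2f; have [mf _] := L2f.
rewrite -(eq_ae_sqint (mT mf) (mrwce f mW) (TE mf)).
apply: sqint_le_opnorm => // c {L2f mf}f c0 mf.
have mcf : cmeasurable (fun x => real_complex R c * f x)%R.
  by apply: cmeasurableM => //; exact/cmeasurable_real/measurable_cst.
by apply: filterS3 (TE mcf) (TE mf) (rwceZ W c0 mf) => x -> -> ->.
Qed.

Lemma gauge_bounded_op (D : R) : (0 <= D)%R ->
  {ae mu, forall x, wce_gauge x <= D%:E} -> bounded_op mu T.
Proof.
move=> D0 leD.
have TD f : L2 mu f -> sqint mu (T f) <= (4 * D)%:E * sqint mu f.
  move=> [mf _]; rewrite (eq_ae_sqint (mT mf) (mrwce f mW) (TE mf)).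
  exact: (sqint_rwce_le A_sigma A_sub A_sfinite).
have D4 : (0 <= 4 * D)%R by rewrite mulr_ge0.
split.
  move=> f L2f; have [mf ffin] := (L2P mu f).1 L2f.
  apply/L2P; split; first exact: mT.
  by apply: (le_lt_trans (TD _ L2f)); rewrite lte_mul_pinfty ?lee_fin.
apply: (@le_lt_trans _ _ (4 * D + 1)%:E); last by rewrite ltry.
apply: opnorm_le; first by rewrite addr_ge0.
move=> f L2f; apply: (le_trans (TD _ L2f)); apply: lee_wpmul2r.
  exact: sqint_ge0.
by rewrite lee_fin expr2; nra.
Qed.

(** Cesaro boundedness of a bounded T, expressed by the gauge of v_n W and U. *)
Definition cesaro_growth := exists2 C : R, (0 <= C)%R &
  forall n, (0 < n)%N ->
  {ae mu, forall x, (geom n x ^+ 2)%:E * wce_gauge x <= ((C * n%:R) ^+ 2)%:E}.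

(** M_(v_n W) E M_U is n times the n-th Cesaro mean of T minus the identity, so
    its norm grows at most linearly, and [rwce_bound_gauge_le] applies. *)
Lemma cesaro_bounded_growth : cesaro_bounded mu T -> cesaro_growth.
Proof.
move=> [_ [C0 hC0]].
have [C C_ge0 hC] : exists2 C : R, (0 <= C)%R &
    forall n, (0 < n)%N -> opnorm mu (cesaro_mean T n) <= C%:E.
  exists (Num.max C0 0)%R; first by rewrite le_max lexx orbT.
  by move=> n /hC0 h; apply: (le_trans h); rewrite lee_fin le_max lexx.
exists (2 * C + 2)%R; first by rewrite addr_ge0// mulr_ge0.
move=> n n0; set N : R := n%:R.
have N1 : (1 <= N)%R by rewrite ler1n.
have D0 : (0 <= 2 * (N ^+ 2 * C ^+ 2 + 1))%R.
  by rewrite mulr_ge0// addr_ge0// mulr_ge0// sqr_ge0.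
have := @rwce_bound_gauge_le _ X R mu A A_sigma A_sub A_sfinite (geom n \* W)%R U
  (mgW n) (gW0 n) mU U0 _ D0.
have bound f : L2 mu f -> sqint mu (rwce mu A (geom n \* W)%R U f) <=
    (2 * (N ^+ 2 * C ^+ 2 + 1))%:E * sqint mu f.
  move=> L2f; have [mf _] := L2f.
  have mC := cmeasurable_cesaro n mf.
  have mNC : cmeasurable (fun x => real_complex R N * cesaro_mean T n f x)%R.
    by apply: cmeasurableM => //; exact/cmeasurable_real/measurable_cst.
  have mNf : cmeasurable (fun x => real_complex R (-1) * f x)%R.
    by apply: cmeasurableM => //; exact/cmeasurable_real/measurable_cst.
  have e : {ae mu, forall x, rwce mu A (geom n \* W)%R U f x =
      (real_complex R N * cesaro_mean T n f x + real_complex R (-1) * f x)%R}.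
    apply: filterS (cesaro_meanE n0 mf) => x ->.
    rewrite mulrA -rmorphM/= mulfV ?pnatr_eq0 -?lt0n// rmorph1 mul1r.
    by rewrite rmorphN rmorph1 mulN1r addrAC subrr add0r.
  rewrite (eq_ae_sqint _ _ e); last 2 first.
    exact: mrwce.
    exact: cmeasurableD.
  apply: (le_trans (sqintD_le mu mNC mNf)); rewrite !sqintZ//.
  rewrite sqrrN expr1n mul1e [in leRHS]EFinM -[leRHS]muleA; apply: lee_wpmul2l => //.
  rewrite [in leRHS]EFinD [leRHS]ge0_muleDl ?lee_fin ?mulr_ge0 ?sqr_ge0// mul1e.
  apply: leeD => //; rewrite [in leRHS]EFinM -[leRHS]muleA; apply: lee_wpmul2l.
    by rewrite lee_fin sqr_ge0.
  apply: sqint_le_opnorm => //; last exact: hC.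
  - by move=> g mg; exact: cmeasurable_cesaro.
  - by move=> c g c0 mg; exact: cesaro_meanZ.
move=> /(_ bound); apply: filterS2 (cond_expe_geom n) => x -> h1.
rewrite muleA; apply: (le_trans h1); rewrite lee_fin.
rewrite !expr2; nra.
Qed.

Lemma growth_cesaro_bounded : bounded_op mu T -> cesaro_growth ->
  cesaro_bounded mu T.
Proof.
move=> bT [C C0 hC]; split => //; exists (2 * (1 + 4 * C ^+ 2))%R => n n0.
have M0 : (0 <= 2 * (1 + 4 * C ^+ 2) :> R)%R.
  by rewrite mulr_ge0// addr_ge0// mulr_ge0// sqr_ge0.
apply: opnorm_le => // f L2f; have [mf _] := L2f.
have N0 : (n%:R != 0 :> R)%R by rewrite pnatr_eq0 -lt0n.
have mg : cmeasurable (rwce mu A (geom n \* W)%R U f) by exact: mrwce.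
have ms : cmeasurable (fun x => f x + rwce mu A (geom n \* W)%R U f x)%R.
  exact: cmeasurableD.
rewrite (eq_ae_sqint _ _ (cesaro_meanE n0 mf)); last 2 first.
- exact: cmeasurable_cesaro.
- by apply: cmeasurableM => //; exact/cmeasurable_real/measurable_cst.
rewrite sqintZ//.
have gb : sqint mu (rwce mu A (geom n \* W)%R U f) <=
    (4 * (C * n%:R) ^+ 2)%:E * sqint mu f.
  apply: (sqint_rwce_le A_sigma A_sub A_sfinite) => //; first exact: sqr_ge0.
  by apply: filterS2 (cond_expe_geom n) (hC n n0) => x ->; rewrite muleA.
apply: (@le_trans _ _ ((n%:R^-1 ^+ 2)%:E * (2%:E *
   (sqint mu f + (4 * (C * n%:R) ^+ 2)%:E * sqint mu f)))).
  apply: lee_wpmul2l; first by rewrite lee_fin sqr_ge0.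
  apply: (le_trans (sqintD_le mu mf mg)); apply: lee_wpmul2l => //.
  exact: leeD.
rewrite -{1}(mul1e (sqint mu f)) -ge0_muleDl ?lee_fin ?mulr_ge0 ?sqr_ge0//.
rewrite !muleA -!EFinD -!EFinM; apply: lee_wpmul2r; first exact: sqint_ge0.
rewrite lee_fin.
have N1 : (1 <= n%:R :> R)%R by rewrite ler1n.
have i1 : (n%:R^-1 <= 1 :> R)%R by rewrite invf_le1// ltr0n.
have i0 : (0 <= n%:R^-1 :> R)%R by rewrite invr_ge0.
have -> : (n%:R^-1 ^+ 2 * 2 * (1 + 4 * (C * n%:R) ^+ 2) =
   2 * (n%:R^-1 ^+ 2 + 4 * C ^+ 2))%R by field.
apply: (@le_trans _ _ (2 * (1 + 4 * C ^+ 2))%R).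
  by rewrite ler_pM2l// lerD2r exprn_ile1.
rewrite [leRHS]expr2 ler_peMl//.
by have := sqr_ge0 C; lra.
Qed.

End wce_iterates.

(** * Essential suprema *)

Section sup_norm.
Local Open Scope ereal_scope.
Context d (X : measurableType d) (R : realType).
Variable mu : {measure set X -> \bar R}.

Lemma Lnorm_oo_le (g : X -> \bar R) n (C : R) :
  (0 <= C)%R -> (0 < n)%N -> (forall x, 0 <= g x) ->
  ((n%:R^-1)%:E * Lnorm mu +oo g <= C%:E) <->
  {ae mu, forall x, g x <= (C * n%:R)%:E}.
Proof.
move=> C0 n0 g0.
have N0 : (0 < n%:R :> R)%R by rewrite ltr0n.
have -> : ((n%:R^-1)%:E * Lnorm mu +oo g <= C%:E) =
          (Lnorm mu +oo g <= (C * n%:R)%:E).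
  by rewrite muleC lee_pdivrMr// EFinM.
rewrite unlock; case: ifPn => [_|].
  split => [/ess_supP|h].
    by apply: filterS => x; rewrite /= gee0_abs.
  by apply/ess_supP; apply: filterS h => x; rewrite /= gee0_abs.
rewrite -leNgt measure_le0 => /eqP mu0; split => _.
  by exists setT; split.
by rewrite lee_fin mulr_ge0// ltW.
Qed.

End sup_norm.

(** * The Aluthge transform *)

Section aluthge.
Context d (X : measurableType d) (R : realType).
Variables (mu : {measure set X -> \bar R}) (A : set (set X)).
Hypotheses (A_sigma : sigma_algebra [set: X] A) (A_sub : A `<=` measurable).
Hypothesis A_sfinite : @sigma_finite _ (g_sigma_algebraType A) R setT mu.

Local Notation XA := (g_sigma_algebraType A).
Local Notation E f := (cond_expe mu A (EFin \o f)).

Variables W U : X -> R.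
Hypotheses (mW : measurable_fun setT W) (W0 : forall x, (0 <= W x)%R).
Hypotheses (mU : measurable_fun setT U) (U0 : forall x, (0 <= U x)%R).
Local Notation h := (wce_symbol mu A W U).
Local Notation a := (E (U \* U)).

Definition aluthge_factor x : R := \1_[set y | a y != 0%E] x * h x / fine (a x).

(** The weight w' for which the Aluthge transform is M_w' E M_u. *)
Definition aluthge_weight : X -> R := aluthge_factor \* U.

Lemma aluthge_factor_ge0 x : 0 <= aluthge_factor x.
Proof.
by rewrite /aluthge_factor mulr_ge0 ?mulr_ge0 ?wce_symbol_ge0// invr_ge0 fine_ge0// cond_expe_ge0.
Qed.

Lemma measurable_aluthge_factor : measurable_fun setT (aluthge_factor : XA -> R).
Proof.
have ma : measurable_fun setT (a : XA -> \bar R) by exact: cond_expe_sub_measurable.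
apply: measurable_funM.
  apply: measurable_funM; last exact: measurable_wce_symbol.
  apply: measurable_indic; rewrite -[X in measurable X]setTI.
  exact: emeasurable_neq.
rewrite (_ : (fun x => _) = (@powR R ^~ (-1)) \o (fun x => fine (a x))).
  apply: measurableT_comp; first exact: measurable_powR.
  exact: (measurableT_comp (fine_measurable measurableT)).
by apply/funext => x /=; rewrite powR_inv1// fine_ge0// cond_expe_ge0.
Qed.

Lemma measurable_aluthge_weight : measurable_fun setT aluthge_weight.
Proof.
apply: measurable_funM => //.
exact: (sub_measurable_fun A_sigma A_sub measurable_aluthge_factor).
Qed.

Lemma aluthge_weight_ge0 x : 0 <= aluthge_weight x.
Proof. by rewrite mulr_ge0// aluthge_factor_ge0. Qed.

Local Open Scope ereal_scope.

Let mUU : measurable_fun setT (U \* U)%R. Proof. exact: measurable_funM. Qed.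
Let UU0 x : (0 <= (U \* U) x)%R. Proof. exact: mulr_ge0. Qed.

(** Conditional Cauchy-Schwarz; [fine] can only decrease E(UW). *)
Lemma symbol_sqr_le_gauge :
  {ae mu, forall x, ((h x ^+ 2)%:E <= wce_gauge mu A W U x)%E}.
Proof.
apply: filterS (cond_expe_cauchy_schwarz A_sigma A_sub A_sfinite mU U0 mW W0).
move=> x le_cs; rewrite /wce_gauge muleC; apply: le_trans le_cs.
rewrite /wce_symbol.
case: (E (U \* W)%R x) (cond_expe_ge0 mu A (EFin \o (U \* W)%R) x) => [c| |]//= _.
by rewrite expr0n/= leey.
Qed.

(** The factor s = 1_S h / E(U^2) comes out of E, so the symbol is s E(U^2) and
    the gauge is s^2 E(U^2)^2.  These are h and h^2 where E(U^2) is finite and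
    nonzero.  Elsewhere s = 0, and h = 0 too, because h^2 is at most
    E(W^2) E(U^2): this product is 0 if E(U^2) = 0, and if E(U^2) is infinite its
    boundedness forces E(W^2) = 0. *)
Lemma aluthge_symbol_gauge (D : R) :
  {ae mu, forall x, wce_gauge mu A W U x <= D%:E} ->
  {ae mu, forall x, wce_symbol mu A aluthge_weight U x = h x /\
                    wce_gauge mu A aluthge_weight U x = (h x ^+ 2)%:E}.
Proof.
move=> leD.
have ms := measurable_aluthge_factor; have s0 := aluthge_factor_ge0.
have e1 := cond_expe_pullout A_sigma A_sub A_sfinite ms s0 mUU UU0.
have mss : measurable_fun setT ((aluthge_factor \* aluthge_factor)%R : XA -> R).
  exact: measurable_funM.
have ss0 x : (0 <= (aluthge_factor \* aluthge_factor)%R x)%R by exact: mulr_ge0.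
have e2 := cond_expe_pullout A_sigma A_sub A_sfinite mss ss0 mUU UU0.
apply: filterS2 (filterI e1 e2) (filterI leD symbol_sqr_le_gauge).
move=> x [h1 h2] [h3 h4].
have E1 : E (U \* aluthge_weight)%R x = (aluthge_factor x)%:E * a x.
  rewrite -h1; congr (cond_expe _ _ _ x); apply/funext => y /=; congr EFin.
  by rewrite /aluthge_weight /=; ring.
have E2 : E (aluthge_weight \* aluthge_weight)%R x =
    ((aluthge_factor x) * (aluthge_factor x))%:E * a x.
  rewrite -h2; congr (cond_expe _ _ _ x); apply/funext => y /=; congr EFin.
  by rewrite /aluthge_weight /=; ring.
rewrite {1}/wce_symbol E1 {1}/wce_gauge E2.
move: h3 h4; rewrite /wce_gauge /aluthge_factor indicE.
move: (h x) (E (W \* W)%R x) (cond_expe_ge0 mu A (EFin \o (W \* W)%R) x).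
move=> {h1 h2 E1 E2}c e e0 leD' lec.
have [ax0|ax0] := eqVneq (a x) 0.
  have c0 : c = 0%R.
    move: lec; rewrite ax0 mule0 lee_fin => c2.
    by apply/eqP; rewrite -sqrf_eq0 eq_le c2 sqr_ge0.
  by rewrite ax0 c0 !mule0 expr0n.
rewrite mem_set// mul1r.
have := cond_expe_ge0 mu A (EFin \o (U \* U)%R) x.
move: ax0 leD' lec; case: (a x) => [r| |]//.
  rewrite eqe => r0 _ _ _ /=; rewrite -!EFinM; split; first by field.
  by congr EFin; field.
move=> _ leD' lec _.
have e00 : e = 0.
  move: e0; rewrite le_eqVlt => /predU1P[//|e0].
  by move: leD'; rewrite gt0_muley// leye_eq.
have -> : c = 0%R.
  move: lec; rewrite e00 mul0e lee_fin => c2.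
  by apply/eqP; rewrite -sqrf_eq0 eq_le c2 sqr_ge0.
by rewrite !mul0r !mul0e expr0n.
Qed.

End aluthge.

(** * Real representatives and the four conditions *)

Section real_representatives.
Context d (X : measurableType d) (R : realType).
Variables (mu : {measure set X -> \bar R}) (A : set (set X)).
Hypotheses (A_sigma : sigma_algebra [set: X] A) (A_sub : A `<=` measurable).
Hypothesis A_sfinite : @sigma_finite _ (g_sigma_algebraType A) R setT mu.

Local Notation XA := (g_sigma_algebraType A).
Local Notation E f := (cond_expe mu A (EFin \o f)).

(** A nonnegative representative of w, when w >= 0 almost everywhere; the absolute
    value makes it nonnegative everywhere. *)
Definition absRe (w : X -> R[i]) (x : X) : R := `|complex.Re (w x)|.

Lemma absRe_ge0 w x : 0 <= absRe w x. Proof. exact: normr_ge0. Qed.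

Lemma measurable_absRe w : cmeasurable w -> measurable_fun setT (absRe w).
Proof. by move=> [wr _]; exact: measurableT_comp. Qed.

Lemma absReE w : {ae mu, forall x, 0 <= w x} ->
  {ae mu, forall x, w x = real_complex R (absRe w x)}.
Proof.
apply: filterS => x; rewrite /absRe; case: (w x) => a b.
rewrite lecE /= => /andP[/eqP-> a0]; by rewrite ger0_norm.
Qed.

Variables w u : X -> R[i].
Hypotheses (mw : cmeasurable w) (mcu : cmeasurable u).
Hypothesis w0 : {ae mu, forall x, 0 <= w x}.
Hypothesis u0 : {ae mu, forall x, 0 <= u x}.

Local Notation W := (absRe w).
Local Notation U := (absRe u).
Local Notation h := (wce_symbol mu A W U).

Let mW : measurable_fun setT W. Proof. exact: measurable_absRe. Qed.
Let mU : measurable_fun setT U. Proof. exact: measurable_absRe. Qed.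
Let cmX (f : X -> R[i]) : @cmeasurable _ XA R (f : XA -> R[i]) -> cmeasurable f.
Proof. exact: (sub_cmeasurable A_sigma A_sub). Qed.

Lemma cond_exp_absRe f : cmeasurable f ->
  cond_exp mu A (fun y => u y * f y) =
  cond_exp mu A (fun y => real_complex R (U y) * f y).
Proof.
move=> mf; apply: (eq_ae_cond_exp A_sub).
- exact: cmeasurableM.
- by apply: cmeasurableM => //; exact: cmeasurable_real.
- by apply: filterS (absReE u0) => x <-.
Qed.

Lemma cond_sqr_absRe (v : X -> R[i]) : cmeasurable v ->
  {ae mu, forall x, 0 <= v x} ->
  cond_sqr mu A v = E (absRe v \* absRe v).
Proof.
move=> mv v0; apply: (eq_ae_cond_expe A_sub).
- by apply: measurable_funX; exact: measurable_normc.
- by move=> x; rewrite sqr_ge0.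
- by apply: measurable_funM; exact: measurable_absRe.
- by move=> x; rewrite mulr_ge0 ?absRe_ge0.
- apply: filterS (absReE v0) => x e.
  by rewrite [in LHS]e normcR ger0_norm ?absRe_ge0// expr2.
Qed.

Lemma cond_exp_symbol : {ae mu, forall x,
  cond_exp mu A (fun y => u y * w y) x = real_complex R (h x)}.
Proof.
have mUW : measurable_fun setT (U \* W) by exact: measurable_funM.
have UW0 x : 0 <= (U \* W) x by rewrite mulr_ge0 ?absRe_ge0.
have m1 : @cmeasurable _ XA R ((cst 1 : X -> R[i]) : XA -> R[i]).
  by split; exact: measurable_cst.
rewrite (cond_exp_absRe mw).
have -> : cond_exp mu A (fun y => real_complex R (U y) * w y) =
          cond_exp mu A (fun y => real_complex R ((U \* W) y) * cst 1 y).
  apply: (eq_ae_cond_exp A_sub).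
  - by apply: cmeasurableM => //; exact: cmeasurable_real.
  - by apply: cmeasurableM; [exact: cmeasurable_real|exact: cmX].
  - by apply: filterS (absReE w0) => x {1}->; rewrite mulr1 rmorphM.
apply: filterS (cond_exp_pullout A_sigma A_sub A_sfinite mUW UW0 m1) => x ->.
by rewrite mulr1.
Qed.

Lemma cmeasurable_wce f : cmeasurable (wce_op mu A w u f).
Proof. by apply: cmeasurableM => //; exact/cmX/cond_exp_measurable. Qed.

Lemma wce_opE f : cmeasurable f ->
  {ae mu, forall x, wce_op mu A w u f x = rwce mu A W U f x}.
Proof.
move=> mf; apply: filterS (absReE w0) => x e.
by rewrite /wce_op /rwce (cond_exp_absRe mf) [in LHS]e.
Qed.

Local Notation W' := (aluthge_weight mu A W U).

Let aluthge_rewrite f : aluthge_wce mu A w u f = fun x =>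
  real_complex R (\1_[set y | cond_sqr mu A u y != 0%E] x /
                    fine (cond_sqr mu A u x)) *
  (cond_exp mu A (fun y => u y * w y) x *
   (conjc (u x) * cond_exp mu A (fun y => u y * f y) x)).
Proof.
apply/funext => x; rewrite /aluthge_wce rmorphM/= fmorphV/=.
have -> : (\1_[set y | cond_sqr mu A u y != 0%E] x : R[i]) =
          real_complex R (\1_[set y | cond_sqr mu A u y != 0%E] x).
  by rewrite !indicE rmorph_nat.
by rewrite -!mulrA; congr (_ * _); rewrite mulrCA.
Qed.

Lemma cmeasurable_aluthge f : cmeasurable (aluthge_wce mu A w u f).
Proof.
rewrite aluthge_rewrite.
have ma : measurable_fun setT (cond_sqr mu A u : XA -> \bar R).
  exact: cond_expe_sub_measurable.
apply: cmeasurableM.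
  apply: cmeasurable_real.
  apply: (sub_measurable_fun A_sigma A_sub).
  apply: measurable_funM.
    apply: measurable_indic; rewrite -[X in measurable X]setTI.
    exact: emeasurable_neq.
  rewrite (_ : (fun x => _) = (@powR R ^~ (-1)) \o (fun x => fine (cond_sqr mu A u x))).
    apply: measurableT_comp; first exact: measurable_powR.
    exact: (measurableT_comp (fine_measurable measurableT)).
  by apply/funext => x /=; rewrite powR_inv1// fine_ge0// cond_expe_ge0.
apply: cmeasurableM; first exact/cmX/cond_exp_measurable.
apply: cmeasurableM; last exact/cmX/cond_exp_measurable.
case: mcu => ur ui; split.
  by rewrite (_ : (fun x => _) = (fun x => complex.Re (u x)))//;
    apply/funext => x; case: (u x).
rewrite (_ : (fun x => _) = (fun x => - complex.Im (u x))).
  exact: measurable_funN.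
by apply/funext => x; case: (u x).
Qed.

Lemma aluthge_wceE f : cmeasurable f ->
  {ae mu, forall x, aluthge_wce mu A w u f x = rwce mu A W' U f x}.
Proof.
move=> mf; apply: filterS2 (absReE u0) cond_exp_symbol => x e1 e2.
rewrite aluthge_rewrite /rwce e2 (cond_exp_absRe mf).
rewrite (_ : conjc (u x) = real_complex R (U x)); last first.
  by rewrite [in LHS]e1 /=; congr Complex; rewrite oppr0.
rewrite !mulrA -!rmorphM/=; congr (real_complex R _ * _).
by rewrite /aluthge_weight /aluthge_factor (cond_sqr_absRe mcu u0) /=; congr (_ * _);
  rewrite mulrAC.
Qed.

Lemma vsumE n : {ae mu, forall x,
  vsum mu A w u n x = real_complex R (geom mu A W U n x)}.
Proof.
apply: filterS cond_exp_symbol => x e.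
rewrite /vsum /geom rmorph_sum; apply: eq_bigr => i _.
by rewrite e rmorphXn.
Qed.

Lemma vsum_Lnorm_boundedP :
  (exists C : R, forall n : nat, (0 < n)%N ->
     (n%:R^-1%:E * Lnorm mu +oo (fun x => (normc (vsum mu A w u n x))%:E)
      <= C%:E)%E) <->
  (exists2 C : R, 0 <= C & forall n, (0 < n)%N ->
     {ae mu, forall x, geom mu A W U n x <= C * n%:R}).
Proof.
have g0 n x : (0 <= (normc (vsum mu A w u n x))%:E)%E by rewrite lee_fin normc_ge0.
have ve n : {ae mu, forall x, normc (vsum mu A w u n x) = geom mu A W U n x}.
  by apply: filterS (vsumE n) => x ->; rewrite normcR ger0_norm// geom_ge0.
split => [[C hC]|[C C0 hC]].
  exists (Num.max C 0); first by rewrite le_max lexx orbT.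
  move=> n n0.
  have M0 : 0 <= Num.max C 0 by rewrite le_max lexx orbT.
  have /(Lnorm_oo_le _ M0 n0 (g0 n)) : (n%:R^-1%:E *
     Lnorm mu +oo (fun x => (normc (vsum mu A w u n x))%:E) <= (Num.max C 0)%:E)%E.
    by apply: (le_trans (hC n n0)); rewrite lee_fin le_max lexx.
  by apply: filterS2 (ve n) => x ->; rewrite lee_fin.
exists C => n n0; apply/(Lnorm_oo_le _ C0 n0 (g0 n)).
by apply: filterS2 (ve n) (hC n n0) => x ->; rewrite lee_fin.
Qed.

Lemma vsum_gauge_Lnorm_boundedP :
  (exists C : R, forall n : nat, (0 < n)%N ->
     (n%:R^-1%:E
        * Lnorm mu +oo (fun x => (normc (vsum mu A w u n x))%:E
                                * (cond_sqr mu A u x) `^ (2^-1)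
                                * (cond_sqr mu A w x) `^ (2^-1))
      <= C%:E)%E) <->
  cesaro_growth mu A W U.
Proof.
pose G n x := ((normc (vsum mu A w u n x))%:E * (cond_sqr mu A u x) `^ (2^-1)
                * (cond_sqr mu A w x) `^ (2^-1))%E.
have g0 n x : (0 <= G n x)%E.
  by rewrite /G !mule_ge0 ?poweR_ge0// lee_fin normc_ge0.
have ve n : {ae mu, forall x,
    G n x = (((geom mu A W U n x ^+ 2)%:E * wce_gauge mu A W U x) `^ 2^-1)%E}.
  apply: filterS (vsumE n) => x vx.
  rewrite /G vx normcR ger0_norm ?geom_ge0// cond_sqr_absRe// cond_sqr_absRe//.
  rewrite /wce_gauge (muleC (E (W \* W) x)).
  rewrite !poweRM ?mule_ge0 ?cond_expe_ge0 ?lee_fin ?sqr_ge0//.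
  rewrite poweR_EFin powR12_sqrt ?sqr_ge0// sqrtr_sqr ger0_norm ?geom_ge0//.
  by rewrite muleA.
have k0 n x : (0 <= (geom mu A W U n x ^+ 2)%:E * wce_gauge mu A W U x)%E.
  by rewrite /wce_gauge !mule_ge0 ?cond_expe_ge0// lee_fin sqr_ge0.
have equiv n (C : R) : 0 <= C -> (0 < n)%N ->
  (n%:R^-1%:E * Lnorm mu +oo (G n) <= C%:E)%E <->
  {ae mu, forall x, ((geom mu A W U n x ^+ 2)%:E * wce_gauge mu A W U x <=
                     ((C * n%:R) ^+ 2)%:E)%E}.
  move=> C0 n0; have Cn0 : 0 <= C * n%:R by rewrite mulr_ge0.
  split.
    move=> /(Lnorm_oo_le _ C0 n0 (g0 n)); apply: filterS2 (ve n) => x ->.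
    by move=> /(le_half_poweR (k0 n x) Cn0).
  move=> hK; apply/(Lnorm_oo_le _ C0 n0 (g0 n)); apply: filterS2 (ve n) hK.
  by move=> x ->; move=> /(le_half_poweR (k0 n x) Cn0).
split => [[C hC]|[C C0 hC]].
  have M0 : 0 <= Num.max C 0 by rewrite le_max lexx orbT.
  exists (Num.max C 0) => // n n0; apply/equiv => //.
  by apply: (le_trans (hC n n0)); rewrite lee_fin le_max lexx.
by exists C => n n0; apply/equiv => //; exact: hC.
Qed.

(** Multiplying the geometric sum by h shifts it by one, so
    1 + h v_n = v_n + h^(n-1). *)
Lemma geom_le1D n x : geom mu A W U n x <= 1 + geom mu A W U n x * h x.
Proof.
rewrite /geom mulr_suml; case: n.-1 => [|m].
  by rewrite !big_ord0 addr0 ler01.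
rewrite big_ord_recl expr0 lerD2l big_ord_recr/=.
under eq_bigr do rewrite /bump/= add1n exprSr.
by rewrite lerDl mulr_ge0 ?exprn_ge0// wce_symbol_ge0.
Qed.

End real_representatives.

Unset Implicit Arguments.
Set Strict Implicit.

Theorem theorem2p14 (d : measure_display) (X : measurableType d) (R : realType)
    (mu : {sigma_finite_measure set X -> \bar R})
    (mu_complete : measure_is_complete mu)
    (A : set (set X))
    (A_sigma : sigma_algebra [set: X] A)
    (A_sub : A `<=` measurable)
    (A_sfinite : @sigma_finite _ (g_sigma_algebraType A) R setT mu)
    (w u : X -> R[i])
    (w_meas : cmeasurable w) (u_meas : cmeasurable u)
    (w_ge0 : {ae mu, forall x, 0 <= w x})
    (u_ge0 : {ae mu, forall x, 0 <= u x})
    (u_cond : forall f, L2 mu f -> conditionable mu A (fun x => u x * f x))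
    (T_bounded : bounded_op mu (wce_op mu A w u)) :
  [<-> cesaro_bounded mu (wce_op mu A w u);
       cesaro_bounded mu (aluthge_wce mu A w u);
       exists C : R, forall n : nat, (0 < n)%N ->
         (n%:R^-1%:E
            * Lnorm mu +oo (fun x => (normc (vsum mu A w u n x))%:E)
          <= C%:E)%E;
       exists C : R, forall n : nat, (0 < n)%N ->
         (n%:R^-1%:E
            * Lnorm mu +oo (fun x => (normc (vsum mu A w u n x))%:E
                                    * (cond_sqr mu A u x) `^ (2^-1)
                                    * (cond_sqr mu A w x) `^ (2^-1))
          <= C%:E)%E].
Proof.
pose W := absRe w; pose U := absRe u; pose W' := aluthge_weight mu A W U.
have mW : measurable_fun setT W by exact: measurable_absRe.
have mU : measurable_fun setT U by exact: measurable_absRe.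
have W0 x : 0 <= W x by exact: absRe_ge0.
have U0 x : 0 <= U x by exact: absRe_ge0.
have mW' : measurable_fun setT W' by exact: measurable_aluthge_weight.
have W'0 x : 0 <= W' x by exact: aluthge_weight_ge0.
have mT f : cmeasurable f -> cmeasurable (wce_op mu A w u f).
  by move=> _; exact: cmeasurable_wce.
have TE f : cmeasurable f ->
    {ae mu, forall x, wce_op mu A w u f x = rwce mu A W U f x}.
  exact: wce_opE.
have mT' f : cmeasurable f -> cmeasurable (aluthge_wce mu A w u f).
  by move=> _; exact: cmeasurable_aluthge.
have TE' f : cmeasurable f ->
    {ae mu, forall x, aluthge_wce mu A w u f x = rwce mu A W' U f x}.
  exact: aluthge_wceE.
have [D D0 leD] := bounded_op_gauge A_sigma A_sub A_sfinite mW W0 mU U0 mT TE T_bounded.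
have W'E := aluthge_symbol_gauge A_sigma A_sub A_sfinite mW W0 mU U0 leD.
have le_h := symbol_sqr_le_gauge A_sigma A_sub A_sfinite mW W0 mU U0.
have leD' : {ae mu, forall x, (wce_gauge mu A W' U x <= D%:E)%E}.
  apply: filterS3 W'E le_h leD => x [_ ->]; exact: le_trans.
have geom'E : {ae mu, forall x, forall n, geom mu A W' U n x = geom mu A W U n x}.
  by apply: filterS W'E => x [hx _] n; rewrite /geom hx.
tfae.
(* The gauge h^2 of the transform is at most the gauge K of T. *)
- move=> /(cesaro_bounded_growth A_sigma A_sub A_sfinite mW W0 mU U0 mT TE)[C C0 hC].
  apply: (growth_cesaro_bounded A_sigma A_sub A_sfinite mW' W'0 mU U0 mT' TE').
    exact: (gauge_bounded_op A_sigma A_sub A_sfinite mW' W'0 mU U0 mT' TE' D0).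
  exists C; first exact: C0.
  move=> n n0; apply: filterS3 (filterI W'E geom'E) le_h (hC n n0).
  move=> x [[_ ->] ->] le1; apply: le_trans; apply: lee_wpmul2l => //.
  by rewrite lee_fin sqr_ge0.
(* The growth condition for the transform is v_n h <= C n. *)
- move=> /(cesaro_bounded_growth A_sigma A_sub A_sfinite mW' W'0 mU U0 mT' TE')[C C0 hC].
  apply/vsum_Lnorm_boundedP => //; exists (C + 1); first by rewrite addr_ge0.
  move=> n n0; apply: filterS3 W'E geom'E (hC n n0) => x [_ ->] ->.
  rewrite -EFinM lee_fin -exprMn ler_pXn2r ?nnegrE//; last 2 first.
    by rewrite mulr_ge0 ?geom_ge0 ?wce_symbol_ge0.
    by rewrite mulr_ge0.
  move=> le_geom; apply: (le_trans (geom_le1D _ _ _ _ _ _)).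
  by rewrite mulrDl mul1r addrC lerD// ler1n.
- move=> /(vsum_Lnorm_boundedP A_sigma A_sub A_sfinite w_meas u_meas w_ge0 u_ge0)[C C0 hC].
  apply/vsum_gauge_Lnorm_boundedP => //; exists (C * (D + 1)).
    (* D + 1 is a bound for the square root of D. *)
    by rewrite mulr_ge0// addr_ge0.
  move=> n n0; apply: filterS2 leD (hC n n0) => x leDx leC.
  apply: (@le_trans _ _ (((C * n%:R) ^+ 2)%:E * D%:E)%E).
    apply: lee_pmul => //.
    + by rewrite lee_fin sqr_ge0.
    + by rewrite /wce_gauge mule_ge0// cond_expe_ge0.
    + by rewrite lee_fin lerXn2r ?nnegrE ?geom_ge0// mulr_ge0.
  rewrite -EFinM lee_fin (mulrAC C) [leRHS]exprMn ler_wpM2l ?sqr_ge0//.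
  by rewrite expr2; nra.
- move=> /(vsum_gauge_Lnorm_boundedP A_sigma A_sub A_sfinite w_meas u_meas w_ge0 u_ge0).
  exact: (growth_cesaro_bounded A_sigma A_sub A_sfinite mW W0 mU U0 mT TE).
Qed.
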